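(* Let $X$ be an infinite-dimensional complex Banach space, $T\in L(X)$, and let $\mathbf R$ be one of $\mathcal B_+$, $\mathcal B_-$, $\mathcal B$, $\Phi_+$, $\Phi_-$, $\Phi$, $\mathcal W_+$, $\mathcal W_-$, $\mathcal W$. If $0\in\partial\sigma_{\mathbf R}(T)$ and $T$ admits a GKRD, then $0\in\operatorname{iso}\sigma_{\mathbf R}(T)$. Moreover, if $T$ admits a GKRD, then: $0\in\partial\sigma_{ap}(T)$ implies $0\notin\operatorname{acc}\sigma_{\mathcal B_+}(T)$; $0\in\partial\sigma_{su}(T)$ implies $0\notin\operatorname{acc}\sigma_{\mathcal B_-}(T)$; and $0\in\partial\sigma(T)$ implies $0\notin\operatorname{acc}\sigma_{\mathcal B}(T)$.
   Context: $S$ is Kato if $R(S)$ is closed and $N(S)\subset R(S^n)$ for all $n$; $S$ is Riesz if $S-\lambda$ is Fredholm for all $\lambda\ne0$; $T$ admits a GKRD if there are closed $T$-invariant $M,N$ with $X=M\oplus N$, $T_M$ Kato, $T_N$ Riesz. $\Phi_+$: finite-dimensional kernel and closed range; $\Phi_-$: finite-codimensional range; $\Phi=\Phi_+\cap\Phi_-$; $\mathcal W_+$, $\mathcal W_-$, $\mathcal W$: operators in $\Phi_+$, $\Phi_-$, $\Phi$ with index $\le0$, $\ge0$, $=0$; $\mathcal B_+$: $\Phi_+$ with finite ascent; $\mathcal B_-$: $\Phi_-$ with finite descent; $\mathcal B$: Fredholm with finite ascent and descent. $\sigma_{\mathbf R}(T)=\{\lambda:T-\lambda\notin\mathbf R\}$;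 $\sigma_{ap}(T)$ ($\sigma_{su}(T)$) is the set of $\lambda$ with $T-\lambda$ not bounded below (not surjective). $\partial$, $\operatorname{iso}$, $\operatorname{acc}$ denote boundary, isolated points, accumulation points. *)

(* Defs.v *)
From mathcomp Require Import all_boot all_order all_algebra.
From mathcomp Require Import all_classical all_reals all_analysis.
From mathcomp Require Import complex.
Import numFieldTopology.Exports numFieldNormedType.Exports.
Import GRing.Theory Num.Theory.

Set Implicit Arguments.
Unset Strict Implicit.
Unset Printing Implicit Defensive.

Local Open Scope ring_scope.
Local Open Scope classical_set_scope.

(* The complex field C = R[i] over a real field R, with its numClosedField
   (hence topological/normed) structure. *)
Definition Cplx (R : realType) : numClosedFieldType := R[i].

Section LinAlg.
Variables (K : numFieldType) (X : normedModType K).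

Definition span (s : seq X) : set X :=
  [set x | exists c : seq K, x = \sum_(i < size s) c`_i *: s`_i].

Definition subspace (M : set X) : Prop :=
  M 0 /\ forall (a : K) (x y : X), M x -> M y -> M (a *: x + y).

Definition setsum (A B : set X) : set X := [set a + b | a in A & b in B].

Definition finite_dim (M : set X) : Prop := exists s : seq X, span s = M.

Definition is_dim (M : set X) (n : nat) : Prop :=
  (exists s : seq X, size s = n /\ span s = M) /\
  (forall s : seq X, span s = M -> (n <= size s)%N).

Definition finite_codim (M Y : set X) : Prop :=
  exists s : seq X, all (fun v => v \in M) s /\ setsum Y (span s) = M.

Definition is_codim (M Y : set X) (n : nat) : Prop :=
  (exists s : seq X, size s = n /\ all (fun v => v \in M) s /\
                     setsum Y (span s) = M) /\
  (forall s : seq X, all (fun v => v \in M) s -> setsum Y (span s) = M ->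
                     (n <= size s)%N).

(* kernel and range of the restriction f|_M of f to an invariant subspace M *)
Definition ker_on (M : set X) (f : X -> X) : set X := [set x | M x /\ f x = 0].
Definition ran_on (M : set X) (f : X -> X) : set X := f @` M.

(* Semi-Fredholm / Fredholm classes for f|_M (M a closed invariant subspace) *)
Definition PhiPlus_on M f := finite_dim (ker_on M f) /\ closed (ran_on M f).
Definition PhiMinus_on M f := finite_codim M (ran_on M f).
Definition Phi_on M f := PhiPlus_on M f /\ PhiMinus_on M f.

(* index <= 0  (index = dim ker - codim ran, possibly -oo / +oo) *)
Definition ind_le0 M f :=
  (~ finite_codim M (ran_on M f)) \/
  (exists m n, is_dim (ker_on M f) m /\ is_codim M (ran_on M f) n /\ (m <= n)%N).
Definition ind_ge0 M f :=
  (~ finite_dim (ker_on M f)) \/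
  (exists m n, is_dim (ker_on M f) m /\ is_codim M (ran_on M f) n /\ (n <= m)%N).

Definition WPlus_on M f := PhiPlus_on M f /\ ind_le0 M f.
Definition WMinus_on M f := PhiMinus_on M f /\ ind_ge0 M f.
Definition W_on M f := Phi_on M f /\ ind_le0 M f /\ ind_ge0 M f.

Definition fin_ascent_on M (f : X -> X) :=
  exists p : nat, ker_on M (iter p f) = ker_on M (iter p.+1 f).
Definition fin_descent_on M (f : X -> X) :=
  exists q : nat, ran_on M (iter q f) = ran_on M (iter q.+1 f).

Definition BPlus_on M f := PhiPlus_on M f /\ fin_ascent_on M f.
Definition BMinus_on M f := PhiMinus_on M f /\ fin_descent_on M f.
Definition B_on M f := Phi_on M f /\ fin_ascent_on M f /\ fin_descent_on M f.

Definition shift (f : X -> X) (l : K) : X -> X := fun x => f x - l *: x.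

Definition Kato_on M (f : X -> X) :=
  closed (ran_on M f) /\ forall n : nat, ker_on M f `<=` ran_on M (iter n f).
Definition Riesz_on M (f : X -> X) :=
  forall l : K, l != 0 -> Phi_on M (shift f l).

Definition GKRD (f : X -> X) :=
  exists M N : set X,
    [/\ subspace M, subspace N, closed M & closed N] /\
    [/\ f @` M `<=` M, f @` N `<=` N, M `&` N = [set 0] & setsum M N = setT] /\
    Kato_on M f /\ Riesz_on N f.

Inductive opclass := cBPlus | cBMinus | cB | cPhiPlus | cPhiMinus | cPhi
  | cWPlus | cWMinus | cW.

Definition in_class (c : opclass) (f : X -> X) : Prop :=
  match c with
  | cBPlus => BPlus_on setT f | cBMinus => BMinus_on setT f | cB => B_on setT f
  | cPhiPlus => PhiPlus_on setT f | cPhiMinus => PhiMinus_on setT f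
  | cPhi => Phi_on setT f
  | cWPlus => WPlus_on setT f | cWMinus => WMinus_on setT f | cW => W_on setT f
  end.

Definition sigma_class (c : opclass) (f : X -> X) : set K :=
  [set l | ~ in_class c (shift f l)].

Definition invertible (f : X -> X) :=
  exists g : X -> X, continuous g /\ cancel f g /\ cancel g f.
Definition spectrum (f : X -> X) : set K := [set l | ~ invertible (shift f l)].
Definition bounded_below (f : X -> X) :=
  exists c : K, 0 < c /\ forall x, c * `|x| <= `|f x|.
Definition sigma_ap (f : X -> X) : set K :=
  [set l | ~ bounded_below (shift f l)].
Definition sigma_su (f : X -> X) : set K :=
  [set l | ~ (forall y, exists x, shift f l x = y)].
End LinAlg.

Definition boundary {T : topologicalType} (A : set T) : set T :=
  closure A `\` interior A.

(* Main.v *)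
Require Import Defs.
From mathcomp Require Import all_boot all_order all_algebra.
From mathcomp Require Import all_classical all_reals all_analysis.
From mathcomp Require Import complex lra ring.
Import Order.TTheory GRing.Theory Num.Theory.
Import numFieldTopology.Exports numFieldNormedType.Exports.
Local Open Scope ring_scope.
Local Open Scope classical_set_scope.

(* Write X = M + N with T Kato on M and Riesz on N.

   On M, the operators T - l are uniformly regular for |l| < e: every value
   (T - l) x is attained at some x' with |x'| <= C |(T - l) x|.  This makes
   kernels and ranges vary with small gap, so dim ker and codim ran of
   (T - l)|M are constant for |l| < e; moreover (T - l)|M stays Kato, hence has
   finite ascent (descent) only when it is injective (surjective).

   On N, the points l <> 0 are all limits of points where T - l is bijective
   (this propagates along rays from infinity), and a semi-Fredholm operator
   which is a limit of bijective T - mu has finite ascent and descent, hence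
   index 0.

   Thus for 0 < |l| < e membership of T - l in any of the nine classes is
   decided by (T|M) alone and does not depend on l, and it already follows from
   membership of a single T - mu with |mu| < e, mu = 0 allowed. *)

Set Implicit Arguments.
Unset Strict Implicit.
Unset Printing Implicit Defensive.

(** The index is never perturbed as such. On M, kernel dimension and codimension are constant
    separately; on N, finite ascent and descent force index 0, so N adds the same number to both
    sides of an index inequality.

    The delicate point is mu = 0, where the Riesz condition says nothing about T on N. Membership of
    T in a semi-Fredholm class makes T|N semi-Fredholm, and 0 is itself a limit of points where T -
    l is bijective on N; hence the index argument on N still applies there.

    Uniform regularity on M is what the Kato condition buys. For an operator that merely has closed
    range, a kernel can collapse under arbitrarily small perturbations, and C blows up. When the
    kernel lies in the hyperrange, T maps the hyperrange onto itself and is bounded below modulo it,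
    and both properties survive small perturbations.

    The quantitative input is an open mapping theorem for a bounded map on a closed subspace with
    closed range, so restrictions to M and N remain global maps with an invariant subset. *)

Section Scalars.
Variable R : realType.
Implicit Types (a b : Cplx R) (r s : R).

(** The modulus as an element of R: the order of the complex field is partial, and suprema and
    linear arithmetic live in R. *)
Definition modc a : R := complex.Re `|a|.
Definition rc r : Cplx R := real_complex R r.

Lemma modcE a : `|a| = rc (modc a).
Proof. by rewrite /modc /rc; symmetry; apply: (@RRe_real R); apply: normr_real. Qed.

Lemma rc_le r s : (rc r <= rc s) = (r <= s).
Proof. by rewrite /rc (@lecE R) /= eqxx. Qed.

Lemma rc_lt r s : (rc r < rc s) = (r < s).
Proof. by rewrite /rc (@ltcE R) /= eqxx. Qed.

Lemma rcD r s : rc (r + s) = rc r + rc s.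
Proof. exact: (rmorphD (real_complex R)). Qed.

Lemma rcM r s : rc (r * s) = rc r * rc s.
Proof. exact: (rmorphM (real_complex R)). Qed.

Lemma rcI r s : rc r = rc s -> r = s.
Proof. by case. Qed.

Lemma rc_real (c : Cplx R) : 0 <= c -> c = rc (complex.Re c).
Proof. by move=> c0; symmetry; apply: (@RRe_real R); apply: ger0_real. Qed.

Lemma modc_ge0 a : 0 <= modc a.
Proof. by rewrite -rc_le -modcE normr_ge0. Qed.

Lemma modcM a b : modc (a * b) = modc a * modc b.
Proof. by apply: rcI; rewrite rcM -!modcE normrM. Qed.

Lemma modcD a b : modc (a + b) <= modc a + modc b.
Proof. by rewrite -rc_le rcD -!modcE ler_normD. Qed.

Lemma modcN a : modc (- a) = modc a.
Proof. by apply: rcI; rewrite -!modcE normrN. Qed.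

Lemma modc_rc r : modc (rc r) = `|r|.
Proof.
by apply: rcI; rewrite -modcE /rc (@normc_def R) /= expr0n /= addr0 sqrtr_sqr.
Qed.

Lemma modc0 : modc 0 = 0.
Proof. by apply: rcI; rewrite -modcE normr0. Qed.

Lemma modc1 : modc 1 = 1.
Proof. by apply: rcI; rewrite -modcE normr1. Qed.

Lemma modc_eq0 a : modc a = 0 -> a = 0.
Proof. by move=> a0; apply/eqP; rewrite -normr_eq0 modcE a0. Qed.

Lemma modc_gt0 a : a != 0 -> 0 < modc a.
Proof.
move=> a0; rewrite lt_neqAle modc_ge0 andbT eq_sym.
by apply: contra a0 => /eqP/modc_eq0 ->.
Qed.

Lemma modcV a : modc a^-1 = (modc a)^-1.
Proof. by apply: rcI; rewrite -modcE normfV modcE /rc (fmorphV (real_complex R)). Qed.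

Lemma modc_Re a : `|complex.Re a| <= modc a.
Proof. by rewrite -rc_le -modcE; apply: (@normc_ge_Re R). Qed.

Lemma modci : modc ('i%C : Cplx R) = 1.
Proof.
apply: rcI; rewrite -modcE (@normc_def R) /= expr0n /= expr1n add0r.
by rewrite sqrtr1.
Qed.

Lemma modc_Im a : `|complex.Im a| <= modc a.
Proof.
have := modc_Re (- ('i%C : Cplx R) * a).
rewrite modcM modcN modci.
rewrite mul1r; case: a => x y /=.
by rewrite !(mul0r, mul1r, oppr0, sub0r, mulN1r, opprK).
Qed.

Lemma modc_ReIm a : modc a <= `|complex.Re a| + `|complex.Im a|.
Proof.
have -> : a = rc (complex.Re a) + ('i%C : Cplx R) * rc (complex.Im a).
  exact: (@complexE R a).
apply: le_trans (modcD _ _) _; rewrite modcM modci !modc_rc.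
rewrite mul1r; case: a => x y /=.
by rewrite !(mul0r, mul1r, oppr0, sub0r, mulr0, addr0, add0r, subr0).
Qed.

End Scalars.

(** * Real norms, subspaces and the open mapping theorem *)

Lemma half_small (R : realType) (c e : R) :
  0 < e -> exists N, forall n, (N <= n)%N -> c * 2^-1 ^+ n < e.
Proof.
move=> e0; exists (Num.Def.archi_bound (`|c| / e)) => n Nn.
have h2 : (0 : R) < 2 ^+ n by rewrite exprn_gt0.
apply: le_lt_trans (_ : `|c| * 2^-1 ^+ n < e).
  by rewrite ler_wpM2r ?ler_norm// exprn_ge0// invr_ge0.
rewrite exprVn ltr_pdivrMr// mulrC -ltr_pdivrMr//.
apply: lt_le_trans (_ : n%:R <= _).
  apply: lt_le_trans (archi_boundP _) _; first by rewrite divr_ge0// ltW.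
  by rewrite ler_nat.
by rewrite -natrX ler_nat ltnW// ltn_expl.
Qed.

(** The map s -> a + s / 2 has the fixed point 2 a, so finitely many steps bring [d] below 3 a. This
    produces almost nearest points without an infimum. *)
Lemma iter_half (R : realType) (T : Type) (P : T -> Prop) (d : T -> R) (a : R) :
  0 < a -> (exists t, P t) ->
  (forall t, P t -> exists2 t', P t' & d t' <= a + 2^-1 * d t) ->
  exists2 t, P t & d t <= 3 * a.
Proof.
move=> a0 [t0 Pt0] H.
have : forall n, exists2 t, P t & d t <= 2 * a + d t0 * 2^-1 ^+ n.
  elim=> [|n [t Pt dt]]; first by exists t0 => //; rewrite expr0; lra.
  have [t' Pt' dt'] := H t Pt; exists t' => //.
  by rewrite exprS; lra.
have [N HN] := half_small (d t0) a0.
move=> /(_ N) [t Pt dt]; exists t => //.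
by have := HN N (leqnn _); lra.
Qed.

Section LinearMaps.
Variable K : fieldType.

(** Same body as [subspace], but over a bare [lmodType], so that it also applies to the product
    spaces used below. *)
Definition subsp (E : lmodType K) (M : set E) :=
  M 0 /\ forall a x y, M x -> M y -> M (a *: x + y).

Definition lin (E F : lmodType K) (f : E -> F) :=
  forall a x y, f (a *: x + y) = a *: f x + f y.

Section Subsp.
Variables (E : lmodType K) (M : set E).
Hypothesis hM : subsp M.

Lemma subsp0 : M 0. Proof. by case: hM. Qed.
Lemma subspZ a x : M x -> M (a *: x).
Proof. by move=> Mx; rewrite -[a *: x]addr0; apply: hM.2 => //; exact: subsp0. Qed.
Lemma subspD x y : M x -> M y -> M (x + y).
Proof. by move=> Mx My; rewrite -[x]scale1r; apply: hM.2. Qed.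
Lemma subspN x : M x -> M (- x).
Proof. by move=> Mx; rewrite -scaleN1r; apply: subspZ. Qed.
Lemma subspB x y : M x -> M y -> M (x - y).
Proof. by move=> Mx My; apply: subspD => //; apply: subspN. Qed.
End Subsp.

Section Lin.
Variables (E F : lmodType K) (f : E -> F).
Hypothesis hf : lin f.

Lemma linD x y : f (x + y) = f x + f y.
Proof. by rewrite -[x]scale1r hf !scale1r. Qed.
Lemma lin0 : f 0 = 0.
Proof. by apply: (addrI (f 0)); rewrite -linD !addr0. Qed.
Lemma linZ a x : f (a *: x) = a *: f x.
Proof. by rewrite -[a *: x]addr0 hf lin0 addr0. Qed.
Lemma linN x : f (- x) = - f x.
Proof. by rewrite -scaleN1r linZ scaleN1r. Qed.
Lemma linB x y : f (x - y) = f x - f y.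
Proof. by rewrite linD linN. Qed.

Lemma subsp_image D : subsp D -> subsp (f @` D).
Proof.
move=> hD; split; first by exists 0; [exact: subsp0|exact: lin0].
by move=> a _ _ [x Dx <-] [y Dy <-]; exists (a *: x + y); [apply: hD.2|rewrite hf].
Qed.
End Lin.

End LinearMaps.

Section BanachNorm.
Variable R : realType.

(* Real-valued norms on complex vector spaces, so that estimates live in an
   ordered field. Completeness is required for geometric sequences only. *)
Record banach_norm (E : lmodType (Cplx R)) (nm : E -> R) : Prop := BanachNorm {
  nmD : forall x y, nm (x + y) <= nm x + nm y;
  nmZ : forall a x, nm (a *: x) = modc a * nm x;
  nm_eq0 : forall x, nm x = 0 -> x = 0;
  nm_complete : forall (u : nat -> E) (c : R),
    (forall n, nm (u n.+1 - u n) <= c * 2^-1 ^+ n) ->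
    exists l, forall e, 0 < e ->
      exists N, forall n, (N <= n)%N -> nm (l - u n) < e }.

Definition nclosed (E : lmodType (Cplx R)) (nm : E -> R) (Y : set E) :=
  forall x, (forall e, 0 < e -> exists2 y, Y y & nm (x - y) < e) -> Y x.

Section Norm.
Variables (E : lmodType (Cplx R)) (nm : E -> R).
Hypothesis H : banach_norm nm.

Lemma nm0 : nm 0 = 0.
Proof. by rewrite -(scale0r 0) (nmZ H) modc0 mul0r. Qed.
Lemma nmN x : nm (- x) = nm x.
Proof. by rewrite -scaleN1r (nmZ H) modcN modc1 mul1r. Qed.
Lemma nmBC x y : nm (x - y) = nm (y - x).
Proof. by rewrite -nmN opprB. Qed.
Lemma nm_ge0 x : 0 <= nm x.
Proof. by have := nmD H x (- x); rewrite subrr nm0 nmN; lra. Qed.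
Lemma nm_gt0 x : x <> 0 -> 0 < nm x.
Proof.
move=> x0; rewrite lt_neqAle nm_ge0 andbT.
by apply/eqP => /esym/(nm_eq0 H).
Qed.
Lemma nmB x y : nm (x - y) <= nm x + nm y.
Proof. by rewrite -(nmN y) (nmD H). Qed.
Lemma nm_tri y x z : nm (x - z) <= nm (x - y) + nm (y - z).
Proof. by have := nmD H (x - y) (y - z); rewrite addrA subrK. Qed.
Lemma nm_le y x : nm x <= nm y + nm (x - y).
Proof. by have := nmD H y (x - y); rewrite addrC subrK. Qed.

Lemma nm_eq0_small x : (forall e, 0 < e -> nm x <= e) -> x = 0.
Proof.
move=> h; apply: (nm_eq0 H); apply/eqP; rewrite eq_le nm_ge0 andbT.
by apply/ler_addgt0Pr => e e0; rewrite add0r h.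
Qed.

(** Summing the geometric tail turns the bare limit of [nm_complete] into an explicit rate. *)
Lemma geom_limit (u : nat -> E) (c : R) :
  (forall n, nm (u n.+1 - u n) <= c * 2^-1 ^+ n) ->
  exists l, forall n, nm (l - u n) <= 2 * c * 2^-1 ^+ n.
Proof.
move=> hu; have [l hl] := nm_complete H hu; exists l => n.
have tail k : nm (u (n + k)%N - u n) <= 2 * c * 2^-1 ^+ n - 2 * c * 2^-1 ^+ (n + k).
  elim: k => [|k IH]; first by rewrite addn0 !subrr nm0.
  have := nm_tri (u (n + k)%N) (u (n + k.+1)%N) (u n).
  by have := hu (n + k)%N; rewrite addnS exprS; lra.
apply/ler_addgt0Pr => e e0; have [N hN] := hl e e0.
have := nm_tri (u (n + N)%N) l (u n).
have := hN (n + N)%N (leq_addl _ _); have := tail N.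
have c0 : 0 <= c by have := hu 0%N; have := nm_ge0 (u 1%N - u 0%N); rewrite expr0; lra.
have : 0 <= c * 2^-1 ^+ (n + N) by rewrite mulr_ge0// exprn_ge0// invr_ge0.
lra.
Qed.
End Norm.

Section Surj.
Variables (E F : lmodType (Cplx R)) (nE : E -> R) (nF : F -> R).
Hypotheses (HE : banach_norm nE) (HF : banach_norm nF).
Variables (f : E -> F) (B : R) (D : set E).
Hypotheses (hf : lin f) (hB : forall x, nF (f x) <= B * nE x).
Hypotheses (hD : subsp D) (cD : nclosed nE D).

(** Successive approximation: solving up to half of the norm, again and again, gives a geometric
    series of corrections whose sum is an exact solution in the closed set [D]. The set [W] only has
    to contain the successive residuals; the open mapping theorem, the perturbation of surjections
    and the Neumann series are all instances. *)
Lemma approx_surj (W : set F) (C : R) :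
  (forall y, W y -> exists x, [/\ D x, nE x <= C * nF y,
     W (y - f x) & nF (y - f x) <= 2^-1 * nF y]) ->
  forall y, W y -> exists x, [/\ D x, f x = y & nE x <= 2 * C * nF y].
Proof.
move=> h y Wy.
have [g hg] : exists g : F -> E, forall y, W y -> [/\ D (g y), nE (g y) <= C * nF y,
     W (y - f (g y)) & nF (y - f (g y)) <= 2^-1 * nF y].
  have hx y' : exists x, W y' -> [/\ D x, nE x <= C * nF y',
     W (y' - f x) & nF (y' - f x) <= 2^-1 * nF y'].
    by have [/h [x hx]|nW] := EM (W y'); [exists x|exists 0].
  by have [k hk] := choice hx; exists k.
(* [r] lists the residuals and [u] the partial sums of the corrections; [f (u n) = y - r n]
   throughout. *)
pose r := fix r n := if n is k.+1 then r k - f (g (r k)) else y.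
pose u := fix u n := if n is k.+1 then u k + g (r k) else 0.
have hr n : W (r n) /\ nF (r n) <= nF y * 2^-1 ^+ n.
  elim: n => [|n [Wr nr]] /=; first by rewrite expr0 mulr1.
  by have [_ _ W1 n1] := hg _ Wr; split=> //; rewrite exprS; lra.
have Du n : D (u n).
  elim: n => [|n IH] /=; first exact: subsp0.
  by apply: subspD => //; have [] := hg _ (hr n).1.
have fu n : f (u n) = y - r n.
  elim: n => [|n IH] /=; first by rewrite (lin0 hf) subrr.
  by rewrite (linD hf) IH opprB addrA addrAC.
have C0 : y <> 0 -> 0 <= C.
  move=> /(nm_gt0 HF) y0; have [_ + _ _] := hg y Wy => nx.
  by rewrite -(pmulr_lge0 _ y0); apply: le_trans nx; apply: (nm_ge0 HE).
have [y0|/C0{}C0] := EM (y = 0).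
  by exists 0; rewrite y0 (nm0 HE) (nm0 HF) mulr0 (lin0 hf); split=> //; exact: subsp0.
have ngr n : nE (g (r n)) <= (C * nF y) * 2^-1 ^+ n.
  have [Wr nr] := hr n; have [_ + _ _] := hg _ Wr => h1.
  by rewrite -mulrA; apply: le_trans h1 _; apply: ler_wpM2l.
have [l hl] : exists l, forall n, nE (l - u n) <= 2 * (C * nF y) * 2^-1 ^+ n.
  apply: (geom_limit HE) => n /=.
  by rewrite addrC addKr; apply: ngr.
have Dl : D l.
  apply: cD => e e0; have [N hN] := half_small (2 * (C * nF y)) e0.
  by exists (u N) => //; apply: le_lt_trans (hl N) (hN N (leqnn _)).
exists l; split=> //; last first.
  by have := hl 0%N; rewrite subr0 expr0 mulr1 mulrA.
apply/eqP; rewrite -subr_eq0; apply/eqP; apply: (nm_eq0_small HF) => e e0.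
have B0 : 0 <= B \/ forall x, nE x = 0.
  have [a|a] := leP 0 B; [by left|right=> x].
  have := hB x; have := nm_ge0 HF (f x); have := nm_ge0 HE x => h1 h2 h3.
  by nra.
(* The image of [l - u N] contributes [|B| * 2 * C] and the residual contributes 1, both times
   [nF y * 2^-N]. *)
have [N hN] := half_small ((`|B| * 2 * C + 1) * nF y) e0.
have -> : f l - y = f (l - u N) - r N.
  by rewrite (linB hf) fu opprB addrA addrAC addrK.
have := nmB HF (f (l - u N)) (r N).
have := hB (l - u N); have := hl N; have := (hr N).2; have := hN N (leqnn _).
have : B * nE (l - u N) <= `|B| * nE (l - u N).
  by rewrite ler_wpM2r ?ler_norm//; apply: (nm_ge0 HE).
have := ler_wpM2l (normr_ge0 B) (hl N).
lra.
Qed.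

(** Baire's argument inside the closed range. Either the image of some ball is dense in a ball of
    the range, and rescaling feeds [approx_surj]; or there are shrinking nested balls, the n-th step
    avoiding the image of the ball of radius n, and their common point would have no preimage. *)
Lemma open_mapping : nclosed nF (f @` D) ->
  exists2 C, 0 < C & forall y, (f @` D) y ->
    exists x, [/\ D x, f x = y & nE x <= C * nF y].
Proof.
move=> cW; set W := f @` D in cW *.
have sW : subsp W by exact: subsp_image.
have [[n [w0 [r [Ww0 r0 hn]]]]|nBaire] := EM (exists n w0 r, [/\ W w0, 0 < r &
    forall w e, W w -> nF (w - w0) < r -> 0 < e ->
      exists x : E, [/\ D x, nE x <= n%:R & nF (w - f x) < e]]).
  exists (2 * (4 * n.+1%:R / r)); first by rewrite !mulr_gt0// invr_gt0.
  apply: approx_surj => y Wy.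
  have [->|y0] := EM (y = 0).
    exists 0; rewrite (lin0 hf) subr0 (nm0 HE) (nm0 HF) !mulr0.
    by split=> //; exact: subsp0.
  have ny := nm_gt0 HF y0.
  pose t := r / (2 * nF y).
  have t0 : 0 < t by rewrite divr_gt0// mulr_gt0.
  have nmr c (G : lmodType (Cplx R)) (nG : G -> R) (HG : banach_norm nG) x :
      0 < c -> nG (rc c *: x) = c * nG x.
    by move=> c0; rewrite (nmZ HG) modc_rc gtr0_norm.
  (* Two errors of r / 8, divided by t, add up to [nF y / 2], the halving required by
     [approx_surj]. *)
  have rc8 : 0 < r / 8 by rewrite divr_gt0.
  have [x1 [Dx1 nx1 h1]] : exists x : E, [/\ D x, nE x <= n%:R &
       nF (rc t *: y + w0 - f x) < r / 8].
    apply: hn => //; first by apply: sW.2.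
    rewrite addrK (nmr t F)//.
    have -> : t * nF y = r / 2 by rewrite /t; field; rewrite gt_eqF.
    by lra.
  have [x2 [Dx2 nx2 h2]] : exists x : E, [/\ D x, nE x <= n%:R &
       nF (w0 - f x) < r / 8].
    by apply: hn => //; rewrite subrr (nm0 HF).
  pose x := rc t^-1 *: (x1 - x2).
  have tV : 0 < t^-1 by rewrite invr_gt0.
  have Dx : D x by apply: subspZ => //; apply: subspB.
  have tVE : t^-1 * r = 2 * nF y.
    by rewrite /t invf_div mulrVK// unitfE gt_eqF.
  exists x; split => //.
  - rewrite /x (nmr _ _ _ HE)//.
    have := nmB HE x1 x2 => h3.
    have h4 : nE (x1 - x2) <= 2 * n.+1%:R.
      by rewrite -natr1; lra.
    have -> : 4 * n.+1%:R / r * nF y = t^-1 * (2 * n.+1%:R).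
      rewrite /t invf_div; field; lra.
    by rewrite ler_pM2l.
  - by apply: subspB => //; exists x.
  have -> : y - f x = rc t^-1 *: ((rc t *: y + w0 - f x1) - (w0 - f x2)).
    rewrite /x (linZ hf) (linB hf).
    have -> : rc t *: y + w0 - f x1 - (w0 - f x2) = rc t *: y - (f x1 - f x2).
      by rewrite opprB addrA addrAC (addrAC _ (- f x1)) addrK opprB addrA addrAC.
    rewrite [in RHS]scalerBr [in RHS]scalerA -rcM mulVf ?gt_eqF//.
    by rewrite scale1r.
  rewrite (nmr _ _ _ HF)//.
  have := nmB HF (rc t *: y + w0 - f x1) (w0 - f x2) => h3.
  have h4 : nF (rc t *: y + w0 - f x1 - (w0 - f x2)) <= r / 4 by lra.
  have := ler_wpM2l (ltW tV) h4.
  lra.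
exfalso.
have step (p : F * R * nat) : exists q : F * R, W p.1.1 -> 0 < p.1.2 ->
    [/\ W q.1, 0 < q.2, q.2 <= 2^-1 * p.1.2, nF (q.1 - p.1.1) <= p.1.2 - q.2 &
     forall x, D x -> nE x <= p.2%:R -> q.2 < nF (q.1 - f x)].
  have [[W0 r0]|n0] := EM (W p.1.1 /\ 0 < p.1.2); last first.
    by exists p.1 => W0 r0; exfalso; apply: n0.
  apply: contrapT => nq; apply: nBaire; exists p.2, p.1.1, (2^-1 * p.1.2).
  split=> //; first by rewrite mulr_gt0.
  move=> w e Ww nw e0; apply: contrapT => nx; apply: nq.
  (* The first bound keeps the new ball inside the old one and halves the radius; the second keeps
     it away from the image of the ball of radius [p.2]. *)
  pose s := Num.min (2^-1 * p.1.2) (2^-1 * e).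
  have s0 : 0 < s by rewrite lt_min !mulr_gt0.
  have s1 : s <= 2^-1 * p.1.2 by rewrite ge_min lexx.
  have s2 : s <= 2^-1 * e by rewrite ge_min lexx orbT.
  exists (w, s) => _ _; split=> //=; first by lra.
  move=> x Dx nxp; rewrite ltNge; apply/negP => h; apply: nx; exists x; split=> //.
  lra.
have [nx hnx] := choice step.
pose q := fix q n := if n is k.+1 then nx (q k, k) else (0, 1).
have hq n : W (q n).1 /\ 0 < (q n).2.
  elim: n => [|n [W0 r0]] /=; first by split => //; exact: subsp0.
  by have [] := hnx (q n, n) W0 r0.
have hS n : [/\ (q n.+1).2 <= 2^-1 * (q n).2,
    nF ((q n.+1).1 - (q n).1) <= (q n).2 - (q n.+1).2 &
    forall x, D x -> nE x <= n%:R -> (q n.+1).2 < nF ((q n.+1).1 - f x)].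
  by have [W0 r0] := hq n; have [] := hnx (q n, n) W0 r0.
have rn n : (q n).2 <= 2^-1 ^+ n.
  elim: n => [|n IH]; first by rewrite expr0.
  by rewrite exprS; have [h _ _] := hS n; lra.
have [l hl] : exists l, forall n, nF (l - (q n).1) <= 2 * 1 * 2^-1 ^+ n.
  apply: (geom_limit HF) => n; have [_ h _] := hS n.
  by have := (hq n.+1).2; have := rn n; lra.
have tail n k : nF ((q (n + k)%N).1 - (q n).1) <= (q n).2 - (q (n + k)%N).2.
  elim: k => [|k IH]; first by rewrite addn0 !subrr (nm0 HF).
  have := nm_tri HF (q (n + k)%N).1 (q (n + k.+1)%N).1 (q n).1.
  by have [_ + _] := hS (n + k)%N; rewrite addnS; lra.
have lim n : nF (l - (q n).1) <= (q n).2.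
  apply/ler_addgt0Pr => e e0; have [N hN] := half_small (2 * 1) e0.
  have := nm_tri HF (q (n + N)%N).1 l (q n).1.
  have := tail n N; have := hl (n + N)%N; have := hN (n + N)%N (leq_addl _ _).
  by have := (hq (n + N)%N).2; lra.
have [x Dx fx] : W l.
  apply: cW => e e0; have [N hN] := half_small (2 * 1) e0.
  by exists (q N).1; [have [] := hq N|apply: le_lt_trans (hl N) (hN N _)].
pose n := Num.Def.archi_bound (nE x).
have [_ _ /(_ x Dx)] := hS n.
have -> : nE x <= n%:R by apply: ltW; apply: archi_boundP; apply: (nm_ge0 HE).
move=> /(_ isT); rewrite fx (nmBC HF) ltNge => /negP; case; exact: lim.
Qed.
End Surj.

End BanachNorm.

(** * Completeness of the complex field, of products and of X in terms of real norms *)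

Section BanachInstances.
Variable R : realType.

(** The intervals of radius [h n] around [u n] are nested, so the supremum of their left ends lies
    in all of them. *)
Lemma real_geom_limit (u : nat -> R) (c : R) :
  (forall n, `|u n.+1 - u n| <= c * 2^-1 ^+ n) ->
  exists l, forall n, `|l - u n| <= 2 * c * 2^-1 ^+ n.
Proof.
move=> hu; pose h n : R := 2 * c * 2^-1 ^+ n.
have hS n : h n.+1 = h n - c * 2^-1 ^+ n by rewrite /h exprS; lra.
have c0 : 0 <= c by have := hu 0%N; have := normr_ge0 (u 1%N - u 0%N); rewrite expr0; lra.
have h0 n : 0 <= h n by rewrite !mulr_ge0// exprn_ge0// invr_ge0.
have up n k : u n - h n <= u (n + k)%N - h (n + k)%N.
  elim: k => [|k IH]; first by rewrite addn0.
  by have := hu (n + k)%N; rewrite ler_norml addnS hS => /andP[]; lra.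
have dn n k : u (n + k)%N + h (n + k)%N <= u n + h n.
  elim: k => [|k IH]; first by rewrite addn0.
  by have := hu (n + k)%N; rewrite ler_norml addnS hS => /andP[]; lra.
have cmp m n : u m - h m <= u n + h n.
  have := up m n; have := dn n m; have := h0 (m + n)%N.
  by rewrite (addnC n m); lra.
pose S := [set u n - h n | n in [set: nat]].
have supS : has_sup S.
  split; first by exists (u 0%N - h 0%N), 0%N.
  by exists (u 0%N + h 0%N) => _ [m _ <-]; exact: cmp.
exists (sup S) => n; rewrite -/(h n) ler_norml; apply/andP; split.
  have : u n - h n <= sup S by apply: ub_le_sup; [case: supS|exists n].
  by lra.
suff : sup S <= u n + h n by lra.
by apply: ge_sup; [case: supS|move=> _ [m _ <-]; exact: cmp].
Qed.

Lemma complex_banach : @banach_norm R (Cplx R)^o (@modc R).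
Proof.
split; [exact: modcD|exact: modcM|exact: modc_eq0|].
move=> u c hu.
have hRe n : `|complex.Re (u n.+1) - complex.Re (u n)| <= c * 2^-1 ^+ n.
  apply: le_trans (hu n); have := modc_Re (u n.+1 - u n).
  by case: (u n.+1) => ? ?; case: (u n).
have hIm n : `|complex.Im (u n.+1) - complex.Im (u n)| <= c * 2^-1 ^+ n.
  apply: le_trans (hu n); have := modc_Im (u n.+1 - u n).
  by case: (u n.+1) => ? ?; case: (u n).
have [lr hlr] := real_geom_limit hRe; have [li hli] := real_geom_limit hIm.
exists (Complex lr li) => e e0; have [N hN] := half_small (4 * c) e0.
exists N => n Nn; have := hN n Nn; have := hlr n; have := hli n.
have := modc_ReIm (Complex lr li - u n).
by case: (u n) => a b /=; lra.
Qed.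

(** Used for the addition map on M x N and for adjoining one scalar coordinate to a domain. *)
Lemma prod_banach (E F : lmodType (Cplx R)) (nE : E -> R) (nF : F -> R) :
  banach_norm nE -> banach_norm nF ->
  @banach_norm R (E * F)%type (fun p => nE p.1 + nF p.2).
Proof.
move=> HE HF; split.
- by move=> x y /=; have := nmD HE x.1 y.1; have := nmD HF x.2 y.2; lra.
- by move=> a x /=; rewrite (nmZ HE) (nmZ HF) mulrDr.
- move=> [x y] /= h; have := nm_ge0 HE x; have := nm_ge0 HF y => h1 h2.
  by congr pair; [apply: (nm_eq0 HE); lra|apply: (nm_eq0 HF); lra].
move=> u c hu.
have [l hl] : exists l, forall n, nE (l - (u n).1) <= 2 * c * 2^-1 ^+ n.
  apply: (geom_limit HE) => n; have := hu n => /=.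
  by have := nm_ge0 HF ((u n.+1).2 - (u n).2); lra.
have [m hm] : exists m, forall n, nF (m - (u n).2) <= 2 * c * 2^-1 ^+ n.
  apply: (geom_limit HF) => n; have := hu n => /=.
  by have := nm_ge0 HE ((u n.+1).1 - (u n).1); lra.
exists (l, m) => e e0; have [N hN] := half_small (4 * c) e0.
exists N => n Nn /=; have := hN n Nn; have := hl n; have := hm n.
by lra.
Qed.

Lemma modc_nbhs (a : Cplx R) (A : set (Cplx R)) :
  nbhs a A <-> exists2 e : R, 0 < e & forall b, modc (a - b) < e -> A b.
Proof.
rewrite nbhs_ballP; split=> [[e /= e0 he]|[e e0 he]].
  have eE := rc_real (ltW e0); exists (complex.Re e).
    by rewrite -rc_lt -eE.
  by move=> b ab; apply: he; rewrite -ball_normE /= modcE eE rc_lt.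
exists (rc e); first by rewrite /= (rc_lt 0).
by move=> b; rewrite -ball_normE /= modcE rc_lt; exact: he.
Qed.

Variable X : completeNormedModType (Cplx R).

Definition nm (x : X) : R := complex.Re `|x|.

Lemma nmE (x : X) : `|x| = rc (nm x).
Proof. exact: rc_real. Qed.

Lemma nbhs_nm (x : X) (A : set X) :
  nbhs x A <-> exists2 e : R, 0 < e & forall y, nm (x - y) < e -> A y.
Proof.
rewrite nbhs_ballP; split=> [[e /= e0 he]|[e e0 he]].
  have eE := rc_real (ltW e0); exists (complex.Re e).
    by rewrite -rc_lt -eE.
  by move=> y xy; apply: he; rewrite -ball_normE /= nmE eE rc_lt.
exists (rc e); first by rewrite /= (rc_lt 0).
by move=> y; rewrite -ball_normE /= nmE rc_lt; exact: he.
Qed.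

Lemma nm_banach : banach_norm nm.
Proof.
split.
- by move=> x y; rewrite -rc_le rcD -!nmE ler_normD.
- by move=> a x; apply: rcI; rewrite rcM -!nmE -modcE normrZ.
- by move=> x x0; apply/eqP; rewrite -normr_eq0 nmE x0.
move=> u c hu.
have c0 : 0 <= c.
  have := hu 0%N; rewrite expr0 mulr1; apply: le_trans.
  by rewrite -rc_le -nmE normr_ge0.
have tail n k : nm (u (n + k)%N - u n) <= 2 * c * 2^-1 ^+ n.
  suff : nm (u (n + k)%N - u n) <= 2 * c * 2^-1 ^+ n - 2 * c * 2^-1 ^+ (n + k).
    have : 0 <= c * 2^-1 ^+ (n + k) by rewrite mulr_ge0// exprn_ge0// invr_ge0.
    by lra.
  elim: k => [|k IH].
    by rewrite addn0 !subrr -rc_le -nmE normr0.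
  have h : nm (u (n + k.+1)%N - u n) <=
           nm (u (n + k.+1)%N - u (n + k)%N) + nm (u (n + k)%N - u n).
    rewrite -rc_le rcD -!nmE; apply: le_trans (ler_normD _ _).
    by rewrite addrA subrK.
  by have := hu (n + k)%N; rewrite addnS exprS in h *; lra.
have cu : cauchy (u @ \oo).
  apply/cauchyP => e e0; have eE := rc_real (ltW e0).
  have e0' : 0 < complex.Re e by rewrite -rc_lt -eE.
  have [N hN] := half_small (2 * c) e0'.
  exists (u N); exists N => // n /= Nn.
  rewrite -ball_normE /= distrC nmE eE rc_lt.
  rewrite -(subnKC Nn); apply: le_lt_trans (tail _ _) _; exact: hN.
have /cvg_ex[l hl] : cvg (u @ \oo) by apply/cauchy_cvgP.
exists l => e e0.
have : nbhs l [set y | nm (l - y) < e] by apply/nbhs_nm; exists e.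
by move=> /hl [N _ hN]; exists N => n Nn; exact: (hN n).
Qed.

Lemma closed_nclosed (Y : set X) : closed Y <-> nclosed nm Y.
Proof.
split=> [cY x hx|cY x hx]; last first.
  apply: cY => e e0.
  have : nbhs x [set y | nm (x - y) < e] by apply/nbhs_nm; exists e.
  by move=> /hx[y [Yy xy]]; exists y.
apply: cY => A /nbhs_nm[e e0 hA]; have [y Yy xy] := hx e e0.
by exists y; split=> //; exact: hA.
Qed.

Lemma continuous_nm_bounded (T : {linear X -> X}) :
  continuous T -> exists B, forall x, nm (T x) <= B * nm x.
Proof.
move=> /(_ 0) cT.
have : nbhs (T 0) [set y | nm (T 0 - y) < 1] by apply/nbhs_nm; exists 1.
move=> /cT /nbhs_nm[e e0 he]; exists (2 / e) => x.
have H := nm_banach.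
have [->|x0] := EM (x = 0); first by rewrite linear0 (nm0 H) mulr0.
have nx := nm_gt0 H x0.
pose t := e / (2 * nm x).
have t0 : 0 < t by rewrite divr_gt0// mulr_gt0.
have := he (rc t *: x).
rewrite /= linear0 !sub0r !(nmN H) linearZ /= !(nmZ H) modc_rc gtr0_norm//.
have -> : t * nm x = e / 2 by rewrite /t; field; rewrite gt_eqF.
have -> : 2 / e * nm x = t^-1 by rewrite /t invf_div; field; rewrite gt_eqF.
move=> h; have {}h : t * nm (T x) < 1 by apply: h; lra.
by rewrite -(ler_pM2l t0) divff ?gt_eqF// ltW.
Qed.

End BanachInstances.

(** * Dimension of quotients *)

Section Dimension.
Variable K : fieldType.

Section Span.
Variable E : lmodType K.
Implicit Types (Y Z W : set E) (s t : seq E) (v w x : E).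

(** This is Y + K v. Adjoining vectors one at a time gives span and independence modulo Y, so
    quotient dimensions need no quotient space. *)
Definition adj Y v : set E := [set x | exists a, Y (x - a *: v)].

Fixpoint spn Y s : set E := if s is v :: s' then spn (adj Y v) s' else Y.

Fixpoint indep Y s : Prop :=
  if s is v :: s' then ~ Y v /\ indep (adj Y v) s' else True.

Lemma adj_subsp Y v : subsp Y -> subsp (adj Y v).
Proof.
move=> hY; split; first by exists 0; rewrite scale0r subr0; exact: subsp0.
move=> a x y [b hb] [c hc]; exists (a * b + c).
have -> : a *: x + y - (a * b + c) *: v = a *: (x - b *: v) + (y - c *: v).
  by rewrite scalerBr scalerA scalerDl opprD addrACA.
exact: hY.2.
Qed.

Lemma sub_adj Y v : Y `<=` adj Y v.
Proof. by move=> x Yx; exists 0; rewrite scale0r subr0. Qed.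

Lemma mem_adj Y v : subsp Y -> adj Y v v.
Proof. by move=> hY; exists 1; rewrite scale1r subrr; exact: subsp0. Qed.

Lemma adj_sub Y Z v : subsp Z -> Y `<=` Z -> Z v -> adj Y v `<=` Z.
Proof.
move=> hZ YZ Zv x [a /YZ Zx]; rewrite -(subrK (a *: v) x).
by apply: subspD => //; apply: subspZ.
Qed.

Lemma adj_mono Y Z v : Y `<=` Z -> adj Y v `<=` adj Z v.
Proof. by move=> YZ x [a /YZ ha]; exists a. Qed.

Lemma adj_id Y v : subsp Y -> Y v -> adj Y v = Y.
Proof. by move=> hY Yv; apply/seteqP; split; [exact: adj_sub|exact: sub_adj]. Qed.

Lemma adjC Y v w : adj (adj Y v) w = adj (adj Y w) v.
Proof.
by apply/seteqP; split=> x [a [b h]]; exists b, a; move: h; rewrite addrAC.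
Qed.

Lemma adj_exchange Y v w : subsp Y -> adj Y w v -> ~ Y v -> adj Y v = adj Y w.
Proof.
move=> hY Yv nYv; apply/seteqP; split.
  by apply: adj_sub => //; [exact: adj_subsp|exact: sub_adj].
apply: adj_sub; [exact: adj_subsp|exact: sub_adj|].
have [a ha] := Yv; have a0 : a != 0.
  by apply: contra_notN nYv => /eqP a0; move: ha; rewrite a0 scale0r subr0.
exists a^-1; have -> : w - a^-1 *: v = - a^-1 *: (v - a *: w).
  by rewrite scalerBr scalerA mulNr mulVf// scaleN1r opprK addrC scaleNr.
exact: subspZ.
Qed.

Lemma spn_subsp Y s : subsp Y -> subsp (spn Y s).
Proof. by elim: s Y => //= v s IH Y hY; apply/IH/adj_subsp. Qed.

Lemma sub_spn Y s : Y `<=` spn Y s.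
Proof.
elim: s Y => [|v s IH] Y //=.
exact: subset_trans (@sub_adj Y v) (IH _).
Qed.

Lemma mem_spn Y s v : subsp Y -> v \in s -> spn Y s v.
Proof.
elim: s Y => //= w s IH Y hY; rewrite inE => /orP[/eqP ->|]; last first.
  by apply: IH; exact: adj_subsp.
by apply: sub_spn; exact: mem_adj.
Qed.

Lemma spn_sub Y Z s : subsp Z -> Y `<=` Z -> (forall v, v \in s -> Z v) ->
  spn Y s `<=` Z.
Proof.
move=> hZ; elim: s Y => //= w s IH Y YZ sZ; apply: IH.
  by apply: adj_sub => //; apply: sZ; rewrite mem_head.
by move=> v vs; apply: sZ; rewrite inE vs orbT.
Qed.

Lemma spn_mono Y Z s : Y `<=` Z -> spn Y s `<=` spn Z s.
Proof. by elim: s Y Z => //= v s IH Y Z YZ; apply/IH/adj_mono. Qed.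

Lemma spn_cat Y s t : spn Y (s ++ t) = spn (spn Y s) t.
Proof. by elim: s Y => //= v s IH Y. Qed.

Lemma indep_cat Y s t : indep Y (s ++ t) <-> indep Y s /\ indep (spn Y s) t.
Proof.
elim: s Y => //= [|v s IH] Y; first by split=> [|[]].
by rewrite IH; split=> [[? []]|[[]]].
Qed.

Lemma indep_mono Y Z s : Y `<=` Z -> indep Z s -> indep Y s.
Proof.
elim: s Y Z => //= v s IH Y Z YZ [nZ iZ]; split=> [/YZ //|].
by apply: IH iZ; exact: adj_mono.
Qed.

(** The vector dropped from [t] is the first one whose adjunction brings [v] into the span; by
    exchange, [v] can stand in for it. *)
Lemma spn_exchange Y t v : subsp Y -> spn Y t v -> ~ Y v ->
  exists t', size t = (size t').+1 /\ spn (adj Y v) t' = spn Y t.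
Proof.
elim: t Y => [//|w t IH] Y hY /= tv nYv.
have [wv|nwv] := EM (adj Y w v); first by exists t; rewrite (adj_exchange hY wv).
have [t' [st' et']] := IH _ (adj_subsp w hY) tv nwv.
by exists (w :: t'); rewrite /= st' adjC et'.
Qed.

Lemma steinitz Y s t : subsp Y -> indep Y s -> (forall v, v \in s -> spn Y t v) ->
  (size s <= size t)%N.
Proof.
elim: s Y t => [//|v s IH] Y t hY /= [nYv iv] st.
have tv : spn Y t v by apply: st; exact: mem_head.
have [t' [-> et']] := spn_exchange hY tv nYv.
rewrite ltnS; apply: (IH (adj Y v)) => //; first exact: adj_subsp.
by move=> w ws; rewrite et'; apply: st; rewrite inE ws orbT.
Qed.

(* [dim_ge Z Y m] : dim Z/Y >= m;  [qdim Z Y m] : dim Z/Y = m. *)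
Definition dim_ge Z Y m :=
  exists s, [/\ size s = m, forall v, v \in s -> Z v & indep Y s].

Definition qdim Z Y m := exists s, [/\ size s = m, indep Y s & spn Y s = Z].

Definition qfin Z Y := exists m, qdim Z Y m.

Lemma dim_ge_mono Z Z' Y Y' m : Z `<=` Z' -> Y' `<=` Y -> dim_ge Z Y m -> dim_ge Z' Y' m.
Proof.
move=> ZZ YY [s [sm sZ iY]]; exists s; split=> //; first by move=> v /sZ /ZZ.
exact: indep_mono iY.
Qed.

Lemma qdim_ge Z Y m : subsp Y -> qdim Z Y m -> dim_ge Z Y m.
Proof.
move=> hY [s [sm iY <-]]; exists s; split=> // v vs; exact: mem_spn.
Qed.

Lemma qdim_le Z Y m n : subsp Y -> qdim Z Y m -> dim_ge Z Y n -> (n <= m)%N.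
Proof. by move=> hY [s [<- _ sZ]] [t [<- tZ it]]; apply: (steinitz hY); rewrite ?sZ. Qed.

Lemma qdim_uniq Z Y m n : subsp Y -> qdim Z Y m -> qdim Z Y n -> m = n.
Proof.
move=> hY hm hn; apply/eqP; rewrite eqn_leq.
by rewrite (qdim_le hY hn (qdim_ge hY hm)) (qdim_le hY hm (qdim_ge hY hn)).
Qed.

Lemma qdim_subsp Z Y m : subsp Y -> qdim Z Y m -> subsp Z.
Proof. by move=> hY [s [_ _ <-]]; exact: spn_subsp. Qed.

(** Vectors of Z outside the current span are chosen greedily: either they run out before m steps,
    or there are m of them. Infinite dimension thus becomes [dim_ge] for every m. *)
Lemma qdim_or_ge Z Y m : subsp Z -> subsp Y -> Y `<=` Z ->
  (exists2 n, (n < m)%N & qdim Z Y n) \/ dim_ge Z Y m.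
Proof.
move=> hZ hY YZ; elim: m => [|m [[n nm qn]|[s [sm sZ iY]]]].
- by right; exists [::].
- by left; exists n => //; apply: ltnW.
have [e|ne] := EM (spn Y s = Z); first by left; exists m => //; exists s.
right; have [z Zz nz] : exists2 z, Z z & ~ spn Y s z.
  apply: contrapT => h; apply: ne; apply/seteqP; split; first exact: spn_sub.
  by move=> z Zz; apply: contrapT => nz; apply: h; exists z.
exists (rcons s z); split.
- by rewrite size_rcons sm.
- by move=> v; rewrite mem_rcons inE => /orP[/eqP -> //|/sZ].
- by rewrite -cats1; apply/indep_cat; split.
Qed.

Lemma qfinP Z Y : subsp Z -> subsp Y -> Y `<=` Z ->
  qfin Z Y <-> exists m, ~ dim_ge Z Y m.
Proof.
move=> hZ hY YZ; split=> [[m qm]|[m nm]].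
  by exists m.+1 => /(qdim_le hY qm); rewrite ltnn.
by have [[n _ qn]|//] := qdim_or_ge m hZ hY YZ; exists n.
Qed.

Lemma qdimP Z Y m : subsp Z -> subsp Y -> Y `<=` Z ->
  qdim Z Y m <-> dim_ge Z Y m /\ ~ dim_ge Z Y m.+1.
Proof.
move=> hZ hY YZ; split=> [qm|[gm ngm]].
  by split; [exact: qdim_ge|move=> /(qdim_le hY qm); rewrite ltnn].
have [[n nm qn]|//] := qdim_or_ge m.+1 hZ hY YZ.
have mn := qdim_le hY qn gm.
by have -> : m = n by apply/eqP; rewrite eqn_leq mn -ltnS.
Qed.

Lemma qdim_add Z W Y m n : qdim W Y m -> qdim Z W n -> qdim Z Y (m + n).
Proof.
move=> [s [<- is_ es]] [t [<- it et]]; exists (s ++ t); rewrite size_cat spn_cat es.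
by split=> //; apply/indep_cat; rewrite es.
Qed.

Lemma qdim_split Z W Y n : subsp Y -> subsp W -> Y `<=` W -> W `<=` Z ->
  qdim Z Y n -> exists a b, [/\ qdim W Y a, qdim Z W b & n = (a + b)%N].
Proof.
move=> hY hW YW WZ qn.
have hZ := qdim_subsp hY qn; have YZ := subset_trans YW WZ.
have [[a _ qa]|ga] := qdim_or_ge n.+1 hW hY YW; last first.
  have /(qdim_le hY qn) : dim_ge Z Y n.+1 by exact: dim_ge_mono ga.
  by rewrite ltnn.
have [[b _ qb]|gb] := qdim_or_ge n.+1 hZ hW WZ; last first.
  have /(qdim_le hY qn) : dim_ge Z Y n.+1 by exact: dim_ge_mono gb.
  by rewrite ltnn.
exists a, b; split=> //; exact: qdim_uniq hY qn (qdim_add qa qb).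
Qed.

Lemma qdim0 Z Y : qdim Z Y 0 -> Z = Y.
Proof. by move=> [[|v s] [] //= _ _ ->]. Qed.

Lemma qdim_refl Y : qdim Y Y 0.
Proof. by exists [::]. Qed.

(** Strong induction on dim Z k / Y: if the chain is not yet stationary at k, some later term has
    strictly smaller dimension. *)
Lemma decreasing_stationary (Z : nat -> set E) Y :
  subsp Y -> (forall k, subsp (Z k)) -> (forall k, Y `<=` Z k) ->
  (forall k, Z k.+1 `<=` Z k) -> qfin (Z 0%N) Y ->
  exists k, forall n, (k <= n)%N -> Z n = Z k.
Proof.
move=> hY hZ YZ dZ [m qm].
have dn k j : Z (k + j)%N `<=` Z k.
  elim: j => [|j IH]; first by rewrite addn0.
  by rewrite addnS; apply: subset_trans (dZ _) IH.
have hq k : exists2 d, (d <= m)%N & qdim (Z k) Y d.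
  have [a [b [qa _ ->]]] := qdim_split hY (hZ k) (YZ k) (dn 0%N k) qm.
  by exists a => //; exact: leq_addr.
suff : forall d k, qdim (Z k) Y d -> exists k, forall n, (k <= n)%N -> Z n = Z k.
  by move=> /(_ m 0%N qm).
elim/ltn_ind => d IH k qk.
have [h|nh] := EM (forall n, (k <= n)%N -> Z n = Z k); first by exists k.
have [n kn nen] : exists2 n, (k <= n)%N & Z n <> Z k.
  by apply: contrapT => h; apply: nh => n kn; apply: contrapT => ne; apply: h; exists n.
have ZZ : Z n `<=` Z k by rewrite -(subnKC kn); exact: dn.
have [a [b [qa qb e]]] := qdim_split hY (hZ n) (YZ n) ZZ qk.
case: b qb e => [/qdim0 //|b] qb e; first by case: nen.
by apply: (IH a _ n qa); rewrite e addnS ltnS leq_addr.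
Qed.

Lemma increasing_stationary (Y : nat -> set E) Z :
  subsp Z -> (forall k, subsp (Y k)) -> (forall k, Y k `<=` Z) ->
  (forall k, Y k `<=` Y k.+1) -> qfin Z (Y 0%N) ->
  exists k, forall n, (k <= n)%N -> Y n = Y k.
Proof.
move=> hZ hY YZ dY [m qm].
have dn k j : Y k `<=` Y (k + j)%N.
  elim: j => [|j IH]; first by rewrite addn0.
  by rewrite addnS; apply: subset_trans IH (dY _).
suff : forall d k, qdim Z (Y k) d -> exists k, forall n, (k <= n)%N -> Y n = Y k.
  by move=> /(_ m 0%N qm).
elim/ltn_ind => d IH k qk.
have [h|nh] := EM (forall n, (k <= n)%N -> Y n = Y k); first by exists k.
have [n kn nen] : exists2 n, (k <= n)%N & Y n <> Y k.
  by apply: contrapT => h; apply: nh => n kn; apply: contrapT => ne; apply: h; exists n.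
have YY : Y k `<=` Y n by rewrite -(subnKC kn); exact: dn.
have [a [b [qa qb e]]] := qdim_split (hY k) (hY n) YY (YZ n) qk.
case: a qa e => [/qdim0 //|a] qa e.
by apply: (IH b _ n qb); rewrite e addSn ltnS leq_addl.
Qed.
End Span.

Section Image.
Variables (E F : lmodType K) (f : E -> F).
Hypothesis hf : lin f.

(* f induces an isomorphism A/(A n f^-1 B) -> (f A + B)/B. *)
Lemma adj_preimage (A : set E) (B : set F) v : subsp A -> A v ->
  adj (A `&` f @^-1` B) v = A `&` f @^-1` (adj B (f v)).
Proof.
move=> hA Av; apply/seteqP; split=> x.
  move=> [a [Ax Bx]]; split.
    by rewrite -(subrK (a *: v) x); apply: subspD => //; apply: subspZ.
  by exists a; move: Bx; rewrite /= (linB hf) (linZ hf).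
move=> [Ax [a Bx]]; exists a; split=> /=; last by rewrite (linB hf) (linZ hf).
by apply: subspB => //; apply: subspZ.
Qed.

Lemma indep_image (A : set E) (B : set F) s : subsp A ->
  (forall v, v \in s -> A v) ->
  indep (A `&` f @^-1` B) s -> indep B (map f s).
Proof.
move=> hA; elim: s B => //= v s IH B sA [nv iv].
have Av : A v by apply: sA; exact: mem_head.
split=> [Bv|]; first exact: nv.
apply: IH; last by rewrite -adj_preimage.
by move=> w ws; apply: sA; rewrite inE ws orbT.
Qed.

Lemma dim_ge_image (A : set E) (B : set F) (C : set F) m : subsp A ->
  f @` A `<=` C -> dim_ge A (A `&` f @^-1` B) m -> dim_ge C B m.
Proof.
move=> hA AC [s [sm sA iA]]; exists (map f s); split.
- by rewrite size_map.
- by move=> _ /mapP[v /sA Av ->]; apply: AC; exists v.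
- exact: indep_image iA.
Qed.

(** With f = [id] this computes (A + B)/B as A/(A n B); with B = 0 it is rank-nullity; with f
    replaced by an iterate it compares successive ranges. *)
Lemma qdim_image (A : set E) (B : set F) (C : set F) m : subsp A -> subsp B ->
  subsp C -> B `<=` C -> f @` A `<=` C ->
  (forall y, C y -> exists x b, [/\ A x, B b & y = f x + b]) ->
  qdim A (A `&` f @^-1` B) m -> qdim C B m.
Proof.
move=> hA hB hC BC AC CAB [s [sm iA eA]].
have sA v : v \in s -> A v.
  move=> vs; rewrite -eA; apply: mem_spn => //; split.
    by split; [exact: subsp0|rewrite /= (lin0 hf); exact: subsp0].
  move=> a x y [Ax Bx] [Ay By]; split; first exact: hA.2.
  by rewrite /= hf; exact: hB.2.
exists (map f s); split; [by rewrite size_map|exact: indep_image iA|].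
apply/seteqP; split.
  by apply: spn_sub => // _ /mapP[v /sA Av ->]; apply: AC; exists v.
have sp : forall B', subsp B' -> spn (A `&` f @^-1` B') s = A `&` f @^-1` (spn B' (map f s)).
  elim: s {sm iA eA} sA => //= v s IH sA B' hB'.
  have Av : A v by apply: sA; exact: mem_head.
  rewrite adj_preimage// IH//; last exact: adj_subsp.
  by move=> w ws; apply: sA; rewrite inE ws orbT.
move=> y /CAB[x [b [Ax Bb ->]]].
have hS := spn_subsp (map f s) hB.
apply: subspD => //; last exact: sub_spn.
by move: Ax; rewrite -{1}eA sp// => -[].
Qed.

Lemma qfin_image_inv (A : set E) (B : set F) (C : set F) : subsp A -> subsp B ->
  f @` A `<=` C -> qfin C B -> qfin A (A `&` f @^-1` B).
Proof.
move=> hA hB AC [m qm].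
have hAB : subsp (A `&` f @^-1` B).
  split; first by split; [exact: subsp0|rewrite /= (lin0 hf); exact: subsp0].
  move=> a x y [Ax Bx] [Ay By]; split; first exact: hA.2.
  by rewrite /= hf; exact: hB.2.
apply/qfinP => //; exists m.+1 => /(dim_ge_image hA AC) /(qdim_le hB qm).
by rewrite ltnn.
Qed.
End Image.

End Dimension.

(** * Gaps and stability of dimensions *)

Section DefsDimension.
Variables (K : numFieldType) (X : normedModType K).
Implicit Types (M Y : set X) (s : seq X).

Lemma span_nil : Defs.span [::] = [set (0 : X)].
Proof.
apply/seteqP; split=> x /=; first by move=> [c ->]; rewrite big_ord0.
by move=> ->; exists [::]; rewrite big_ord0.
Qed.

Lemma span_cons (v : X) s : Defs.span (v :: s) = adj (Defs.span s) v.
Proof.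
apply/seteqP; split=> x.
  move=> [c ->] /=; exists c`_0, (behead c).
  rewrite big_ord_recl /= addrC addKr.
  by apply: eq_bigr => i _; rewrite nth_behead.
move=> [a [c hc]]; exists (a :: c).
by rewrite big_ord_recl /= -hc addrC subrK.
Qed.

Lemma spn_span Y s : subsp Y -> spn Y s = setsum Y (Defs.span s).
Proof.
elim: s Y => [|v s IH] Y hY.
  rewrite span_nil; apply/seteqP; split=> x.
    by move=> Yx; exists x => //; exists 0 => //; rewrite addr0.
  by move=> [y Yy [_ -> <-]]; rewrite addr0.
rewrite /= IH; last exact: adj_subsp.
rewrite span_cons; apply/seteqP; split=> _ [y hy [z hz <-]].
  have [a Yy] := hy; exists (y - a *: v) => //; exists (z + a *: v).
    by exists a; rewrite addrK.
  by rewrite addrACA addNr addr0.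
have [a Zz] := hz; exists (y + a *: v); first by exists a; rewrite addrK.
by exists (z - a *: v) => //; rewrite addrACA subrr addr0.
Qed.

Lemma subsp_set0 : subsp [set (0 : X)].
Proof. by split=> // a x y -> ->; rewrite scaler0 addr0. Qed.

Lemma spn0_span s : spn [set 0] s = Defs.span s.
Proof.
rewrite spn_span; last exact: subsp_set0.
apply/seteqP; split=> x; first by move=> [_ -> [y hy <-]]; rewrite add0r.
by move=> hx; exists 0 => //; exists x => //; rewrite add0r.
Qed.

(** The minimal length of a generating list is the quotient dimension: by Steinitz no generating
    list is shorter than an independent one. *)
Lemma is_codimP M Y n : subsp M -> subsp Y -> Y `<=` M ->
  is_codim M Y n <-> qdim M Y n.
Proof.
move=> hM hY YM; have big s k : setsum Y (Defs.span s) = M -> dim_ge M Y k -> (k <= size s)%N.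
  move=> e [t [<- tM it]]; apply: (steinitz hY) => // v /tM.
  by rewrite -e spn_span.
have gen s : spn Y s = M -> all (fun v => v \in M) s /\ setsum Y (Defs.span s) = M.
  move=> es; split; last by rewrite -spn_span.
  by apply/allP => v vs; rewrite in_setE -es; exact: mem_spn.
split=> [[[s [sn [sM e]]] hmin]|qn].
  have [[k kn qk]|/(big _ _ e)] := qdim_or_ge (size s).+1 hM hY YM; last by rewrite ltnn.
  have [t [tk it /gen[tM et]]] := qk.
  suff -> : n = k by [].
  by apply/eqP; rewrite eqn_leq -{1}tk hmin//= -sn -ltnS kn.
split=> [|t tM et]; last exact: (big _ _ et (qdim_ge hY qn)).
by have [s [sn _ /gen[sM es]]] := qn; exists s.
Qed.

Lemma finite_codimP M Y : subsp M -> subsp Y -> Y `<=` M ->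
  finite_codim M Y <-> qfin M Y.
Proof.
move=> hM hY YM; split=> [[s [sM e]]|[n /(is_codimP n hM hY YM) [[s [_ h]] _]]]; last by exists s.
apply/qfinP => //; exists (size s).+1 => -[t [tn tM it]].
have : (size t <= size s)%N.
  by apply: (steinitz hY) => // v /tM; rewrite -e spn_span.
by rewrite tn ltnn.
Qed.

Lemma is_dimP M n : subsp M -> is_dim M n <-> qdim M [set 0] n.
Proof.
move=> hM; have h0 := subsp_set0.
have sM : [set 0] `<=` M by move=> _ ->; exact: subsp0.
rewrite -(is_codimP n hM h0 sM).
have e s : setsum [set 0] (Defs.span s) = Defs.span s by rewrite -spn_span// spn0_span.
have a s : Defs.span s = M -> all (fun v => v \in M) s.
  move=> es; apply/allP => v vs; rewrite in_setE -es -spn0_span; exact: mem_spn.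
split=> [[[s [sn es]] h]|[[s [sn [_ es]]] h]].
  split; first by exists s; rewrite e; split => //; split => //; exact: a.
  by move=> t _; rewrite e; exact: h.
split; first by exists s; rewrite -e.
by move=> t et; apply: h; [exact: a|rewrite e].
Qed.

Lemma finite_dimP M : subsp M -> finite_dim M <-> qfin M [set 0].
Proof.
move=> hM; have h0 := subsp_set0.
have sM : [set 0] `<=` M by move=> _ ->; exact: subsp0.
rewrite -(finite_codimP hM h0 sM); split=> [[s es]|[s [_ es]]].
  exists s; rewrite -spn_span// spn0_span; split=> //.
  apply/allP => v vs; rewrite in_setE -es -spn0_span; exact: mem_spn.
by exists s; rewrite -es -spn_span// spn0_span.
Qed.
End DefsDimension.

(** * Closed subspaces, gaps and closed ranges *)

Section ClosedSubspaces.
Variable R : realType.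

Section Gap.
Variables (E : lmodType (Cplx R)) (nE : E -> R).
Hypothesis H : banach_norm nE.
Implicit Types (Y Z : set E) (v u : E).

Lemma closed_dist Y v : nclosed nE Y -> ~ Y v ->
  exists2 c, 0 < c & forall y, Y y -> c <= nE (v - y).
Proof.
move=> cY nY; apply: contrapT => h; apply: nY; apply: cY => e e0.
apply: contrapT => nh; apply: h; exists e => // y Yy.
by rewrite leNgt; apply/negP => vy; apply: nh; exists y.
Qed.

Lemma adj_bound Y v c : subsp Y -> (forall y, Y y -> c <= nE (v - y)) ->
  forall a y, Y y -> modc a * c <= nE (a *: v + y).
Proof.
move=> hY hc a y Yy; have [->|a0] := eqVneq a 0.
  by rewrite modc0 mul0r; exact: (nm_ge0 H).
have -> : a *: v + y = a *: (v - (- a^-1 *: y)).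
  by rewrite scalerBr scalerA mulrN divff// scaleN1r opprK.
by rewrite (nmZ H) ler_wpM2l ?modc_ge0//; apply: hc; exact: subspZ.
Qed.

(** The positive distance from v to Y makes the coefficient of v a bounded functional on Y + K v, so
    the coefficients of approximating vectors converge. *)
Lemma adj_closed Y v : subsp Y -> nclosed nE Y -> nclosed nE (adj Y v).
Proof.
move=> hY cY; have [Yv|nYv] := EM (Y v); first by rewrite adj_id.
have [c c0 /(adj_bound hY) hc] := closed_dist cY nYv.
move=> x hx.
have : forall n, exists p : E * Cplx R,
    Y (p.1 - p.2 *: v) /\ nE (x - p.1) <= 2^-1 ^+ n.
  move=> n; have [|y [a ya] xy] := hx (2^-1 ^+ n).
    by rewrite exprn_gt0// invr_gt0.
  by exists (y, a); split=> //; exact: ltW.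
move=> /choice[p hp].
have [l hl] : exists l, forall n, modc (l - (p n).2) <= 2 * (2 / c) * 2^-1 ^+ n.
  apply: (geom_limit (complex_banach R)) => n.
  have [Y0 n0] := hp n; have [Y1 n1] := hp n.+1.
  rewrite -(ler_pM2r c0) mulrAC divfK ?gt_eqF//.
  have := hc ((p n.+1).2 - (p n).2) _ (subspB hY Y1 Y0).
  rewrite scalerBl opprB addrACA addKr [_ *: v + _]addrC subrK => /le_trans; apply.
  have := nm_tri H x (p n.+1).1 (p n).1; rewrite (nmBC H _ x) => /le_trans; apply.
  by rewrite exprS in n1; have : 0 <= 2^-1 ^+ n :> R by []; lra.
exists l; apply: cY => e e0.
have [N hN] := half_small (1 + 2 * (2 / c) * nE v) e0.
have [Yp xp] := hp N; exists ((p N).1 - (p N).2 *: v) => //.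
have -> : x - l *: v - ((p N).1 - (p N).2 *: v) =
          (x - (p N).1) - (l - (p N).2) *: v.
  by rewrite scalerBl !opprB addrACA (addrC (- _)) addrACA.
apply: le_lt_trans (nmB H _ _) _; rewrite (nmZ H).
have := ler_wpM2r (nm_ge0 H v) (hl N); have := hN N (leqnn _).
lra.
Qed.

Lemma spn_closed Y s : subsp Y -> nclosed nE Y -> nclosed nE (spn Y s).
Proof.
elim: s Y => //= v s IH Y hY cY.
by apply: IH; [exact: adj_subsp|exact: adj_closed].
Qed.

(** Riesz's lemma with the unit vector obtained from an almost nearest point; the last clause says
    that the coefficient of u on K u + Y is a functional of norm at most 2. *)
Lemma riesz Y Z : subsp Y -> nclosed nE Y -> subsp Z -> Y `<=` Z ->
  (exists2 v, Z v & ~ Y v) ->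
  exists u, [/\ Z u, nE u = 1 & forall a y, Y y -> modc a <= 2 * nE (a *: u + y)].
Proof.
move=> hY cY hZ YZ [v Zv nYv].
have [c c0 hc] := closed_dist cY nYv.
have [y [Yy hy]] : exists y, Y y /\ forall y', Y y' -> 2^-1 * nE (v - y) <= nE (v - y').
  (* If every distance could be more than halved, [iter_half] would reach a distance of at most 3 c
     / 4, below the lower bound c. *)
  apply: contrapT => h.
  have c4 : 0 < c / 4 by rewrite divr_gt0.
  have [||y Yy] := @iter_half R E Y (fun y => nE (v - y)) _ c4.
  - by exists 0; exact: subsp0.
  - move=> y Yy; apply: contrapT => h'; apply: h; exists y; split=> // y' Yy'.
    rewrite leNgt; apply/negP => lt; apply: h'; exists y' => //.
    by have := lt; lra.
  by have := hc y Yy; lra.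
have w0 : 0 < nE (v - y) by apply: lt_le_trans c0 _; exact: hc.
exists (rc (nE (v - y))^-1 *: (v - y)); split.
- by apply: subspZ => //; apply: subspB => //; exact: YZ.
- by rewrite (nmZ H) modc_rc gtr0_norm ?invr_gt0// mulVf// gt_eqF.
move=> a y' Yy'.
have h := @adj_bound Y (v - y) (2^-1 * nE (v - y)) hY.
have {}h := h _ (a * rc (nE (v - y))^-1) y' Yy'.
rewrite scalerA; have : modc (a * rc (nE (v - y))^-1) * (2^-1 * nE (v - y)) = 2^-1 * modc a.
  rewrite modcM modc_rc gtr0_norm ?invr_gt0//; field; by rewrite gt_eqF.
move=> e; rewrite e in h.
suff : 2^-1 * modc a <= nE ((a * rc (nE (v - y))^-1) *: (v - y) + y') by lra.
apply: h => z Yz; rewrite -addrA -opprD; apply: hy; exact: subspD.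
Qed.

(** The one-sided gap of Kato, delta(Y, Z) <= theta. *)
Definition gap Y Z theta := forall y, Y y -> exists2 z, Z z & nE (y - z) <= theta * nE y.

Lemma dim_ge_adj Y Z v m : subsp Y -> subsp Z -> Y `<=` Z -> Z v ->
  dim_ge Z Y m.+1 -> dim_ge Z (adj Y v) m.
Proof.
move=> hY hZ YZ Zv gm.
have [[n nm qn]|//] := qdim_or_ge m hZ (adj_subsp v hY) (adj_sub hZ YZ Zv).
have [Yv|nYv] := EM (Y v).
  rewrite adj_id// in qn; have := qdim_le hY qn gm.
  by rewrite leqNgt ltnS (ltnW nm).
have q1 : qdim (adj Y v) Y 1 by exists [:: v].
have := qdim_le hY (qdim_add q1 qn) gm.
by rewrite add1n ltnS leqNgt nm.
Qed.

(* The dimension of a quotient Z/Y does not drop under perturbations that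
   approximate Z from inside and Y from outside. *)
Lemma dim_ge_gap m : exists2 theta, 0 < theta & forall Y Z Y' Z',
  subsp Y -> nclosed nE Y -> subsp Z -> Y `<=` Z -> subsp Y' ->
  gap Z Z' theta -> gap Y' Y theta -> dim_ge Z Y m -> dim_ge Z' Y' m.
Proof.
elim: m => [|m [th th0 IH]].
  by exists 1 => // Y Z Y' Z' *; exists [::].
(* The bound 1/8 makes the coefficient of v' on Y' + K v' a functional of norm at most 8 ([hb]). The
   gap between the enlarged subspaces is then at most (10 + 8) t, which 30 t <= th covers. *)
pose t := Num.min 8^-1 (th / 30).
have t0 : 0 < t by rewrite lt_min invr_gt0 divr_gt0// ltr0n.
have t8 : t <= 8^-1 by rewrite ge_min lexx.
have tt : 30 * t <= th.
  by have : t <= th / 30 by [rewrite ge_min lexx orbT]; lra.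
exists t => // Y Z Y' Z' hY cY hZ YZ hY' gZ gY gm.
have [|u [Zu u1 hu]] := @riesz Y Z hY cY hZ YZ.
  have [[|v s] [//= _ sZ [nv _]]] := gm.
  by exists v => //; apply: sZ; exact: mem_head.
have [v' Zv' uv] := gZ u Zu; rewrite u1 mulr1 in uv.
have v1 : nE v' <= 1 + t.
  by have := nm_le H u v'; rewrite (nmBC H v') u1; lra.
have hb a y' : Y' y' -> modc a <= 8 * nE (y' + a *: v').
  move=> Yy'; set w := y' + a *: v'.
  have [y Yy yy] := gY y' Yy'.
  have a0 := modc_ge0 a; have w0 := nm_ge0 H w.
  have ny : nE y' <= nE w + modc a * (1 + t).
    have -> : y' = w - a *: v' by rewrite /w addrK.
    apply: le_trans (nmB H _ _) _; rewrite lerD2l (nmZ H).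
    by rewrite ler_wpM2l.
  have := hu a y Yy.
  have -> : a *: u + y = w - (y' - y) + a *: (u - v').
    rewrite /w scalerBr opprB (addrC y') (addrACA _ y') subrr addr0.
    by rewrite (addrC _ y) (addrC (a *: u) (- _)) addrA addrK addrC.
  have := nmD H (w - (y' - y)) (a *: (u - v')); have := nmB H w (y' - y).
  rewrite (nmZ H) => h1 h2 h3.
  have h4 : modc a * nE (u - v') <= modc a * t by rewrite ler_wpM2l.
  have h5 : t * nE y' <= t * (nE w + modc a * (1 + t)) by rewrite ler_wpM2l// ltW.
  have h6 : modc a <= 2 * (nE w + t * (nE w + modc a * (1 + t)) + modc a * t) by lra.
  have h7 : t * nE w <= 8^-1 * nE w by rewrite ler_wpM2r.
  have h8 : modc a * t <= modc a * 8^-1 by rewrite ler_wpM2l.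
  have h9 : modc a * t * t <= modc a * t * 8^-1 by rewrite ler_wpM2l// mulr_ge0// ltW.
  by lra.
have nYv' : ~ Y' v'.
  move=> Yv; have := hb 1 (- v') (subspN hY' Yv).
  by rewrite scale1r addNr (nm0 H) modc1; lra.
(* Y grows by the Riesz vector u and Y' by its approximation v' in Z', which lowers the dimension to
   be found by one. *)
have [||||||||s [sm sZ iY]] := IH (adj Y u) Z (adj Y' v') Z'.
- exact: adj_subsp.
- exact: adj_closed.
- by [].
- exact: adj_sub.
- exact: adj_subsp.
- move=> z Zz; have [z' Zz' zz] := gZ z Zz; exists z' => //.
  by apply: le_trans zz _; rewrite ler_wpM2r ?(nm_ge0 H)//; lra.
- move=> w [a Yw]; have [y Yy yy] := gY _ Yw.
  exists (y + a *: u); first by exists a; rewrite addrK.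
  have := hb a _ Yw; rewrite subrK => wa.
  have -> : w - (y + a *: u) = (w - a *: v' - y) - a *: (u - v').
    by rewrite scalerBr opprB opprD addrA [RHS]addrACA subrK -addrA.
  apply: le_trans (nmB H _ _) _; rewrite (nmZ H).
  have a0 := modc_ge0 a; have w0 := nm_ge0 H w.
  have h1 : modc a * nE (u - v') <= modc a * t by rewrite ler_wpM2l.
  have h2 : nE (w - a *: v') <= nE w + modc a * (1 + t).
    by apply: le_trans (nmB H _ _) _; rewrite lerD2l (nmZ H) ler_wpM2l.
  have h3 : t * nE (w - a *: v') <= t * (nE w + modc a * (1 + t)) by rewrite ler_wpM2l// ltW.
  have h4 : modc a * t <= modc a * 8^-1 by rewrite ler_wpM2l.
  have h5 : t * (nE w + modc a * (1 + t)) <= t * (10 * nE w).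
    by apply: ler_wpM2l; [exact: ltW|lra].
  have h6 : modc a * t <= 8 * nE w * t by rewrite ler_wpM2r// ltW.
  have h7 : 30 * t * nE w <= th * nE w by rewrite ler_wpM2r.
  have h8 : 0 <= t * nE w by rewrite mulr_ge0// ltW.
  by lra.
- exact: dim_ge_adj.
exists (v' :: s); split=> /=; [by rewrite sm| |by []].
by move=> w; rewrite inE => /orP[/eqP -> //|/sZ].
Qed.
End Gap.

(** A range that becomes closed after adding finitely many vectors is closed. The induction changes
    the operator: the coefficient of v becomes an extra coordinate of the domain, so that f(D) + K v
    is again a range, and its open mapping constant bounds that coefficient. *)
Lemma closed_range_of_spn (F : lmodType (Cplx R)) (nF : F -> R) (t : seq F) :
  banach_norm nF ->
  forall (E : lmodType (Cplx R)) (nE : E -> R) (f : E -> F) (B : R) (D : set E),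
  banach_norm nE -> lin f -> (forall x, nF (f x) <= B * nE x) ->
  subsp D -> nclosed nE D -> nclosed nF (spn (f @` D) t) -> nclosed nF (f @` D).
Proof.
move=> HF; elim: t => [//|v t IH] E nE f B D HE hf hB hD cD /=.
have hfD := subsp_image hf hD.
have [fv|nfv] := EM ((f @` D) v).
  by rewrite adj_id//; exact: IH cD.
move=> ct.
pose E' : lmodType (Cplx R) := (E * (Cplx R)^o)%type.
pose f' (p : E') := f p.1 + (p.2 : Cplx R) *: v.
pose D' : set E' := [set p | D p.1].
have HE' := prod_banach HE (complex_banach R).
have hf' : lin f'.
  by move=> a x y; rewrite /f' /= hf !scalerDl -!scalerA scalerDr addrACA.
have B0 : forall x, nF (f x) <= `|B| * nE x.
  move=> x; apply: le_trans (hB x) _.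
  by rewrite ler_wpM2r ?ler_norm//; exact: (nm_ge0 HE).
have hB' x : nF (f' x) <= (`|B| + nF v) * (nE x.1 + modc x.2).
  apply: le_trans (nmD HF _ _) _; rewrite (nmZ HF).
  have := B0 x.1; have := nm_ge0 HF v; have := modc_ge0 x.2; have := nm_ge0 HE x.1.
  by have := normr_ge0 B; nra.
have hD' : subsp D'.
  by split=> [|a x y Dx Dy]; [exact: (subsp0 hD)|exact: hD.2].
have cD' : nclosed (fun p : E' => nE p.1 + modc p.2) D'.
  move=> x hx; apply: cD => e e0; have [y Dy xy] := hx e e0.
  by exists y.1 => //; have := modc_ge0 (x - y).2; move: xy => /=; lra.
have e : f' @` D' = adj (f @` D) v.
  apply/seteqP; split=> x.
    by move=> [p Dp <-]; exists p.2; exists p.1 => //; rewrite /f' addrK.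
  by move=> [a [y Dy h]]; exists (y, a) => //; rewrite /f' /= h subrK.
rewrite -e in ct.
have cA := IH _ _ _ _ _ HE' hf' hB' hD' cD' ct.
have [C C0 hC] := open_mapping HE' HF hf' hB' hD' cD' cA.
rewrite e in cA hC.
move=> w hw.
have [c0 fw] : adj (f @` D) v w.
  by apply: cA => d d0; have [y fy wy] := hw d d0; exists y => //; exact: sub_adj.
have [z|c0n] := eqVneq c0 0; first by move: fw; rewrite z scale0r subr0.
exfalso.
(* A point y of f(D) this close to w gives [w - y] a preimage whose scalar coordinate is smaller
   than [modc c0]. Since v is not in f(D), that coordinate must be c0. *)
have [|y fy wy] := hw (modc c0 / C); first by rewrite divr_gt0// modc_gt0.
have [|[e' c'] [/= De' he' nc]] := hC (w - y).
  exists c0; rewrite addrAC; exact: subspB.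
have : (f @` D) ((c0 - c') *: v).
  have -> : (c0 - c') *: v = f e' + y - (w - c0 *: v).
    have -> : f e' = w - y - c' *: v by rewrite -he' /f' /= addrK.
    by rewrite scalerBl opprB (addrAC (w - y)) subrK [RHS]addrC addrA subrK.
  by apply: subspB => //; apply: subspD => //; exists e'.
have [/subr0_eq cc _|cc h] := eqVneq (c0 - c') 0; last first.
  apply: nfv; have := subspZ hfD (c0 - c')^-1 h.
  by rewrite scalerA mulVf// scale1r.
have := nm_ge0 HE e'.
rewrite ltr_pdivlMr// in wy; rewrite -cc in nc; lra.
Qed.

End ClosedSubspaces.

(** * Perturbation of Kato operators *)

Section Operators.
Variables (R : realType) (X : completeNormedModType (Cplx R)).
Local Notation nm := (@nm R X).
Local Notation H := (nm_banach X).
Local Notation shift := Defs.shift.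
Implicit Types (M N Y : set X) (f : X -> X) (l : Cplx R).

Record bop M f : Prop := Bop {
  bop_sub : subsp M;
  bop_closed : nclosed nm M;
  bop_inv : forall x, M x -> M (f x);
  bop_lin : lin f;
  bop_bound : exists B, forall x, nm (f x) <= B * nm x }.

Lemma pos_bound f (B : R) : (forall x, nm (f x) <= B * nm x) ->
  exists2 B', 0 < B' & forall x, nm (f x) <= B' * nm x.
Proof.
move=> hB; exists (`|B| + 1); first by have := normr_ge0 B; lra.
move=> x; apply: le_trans (hB x) _; rewrite ler_wpM2r ?(nm_ge0 H)//.
by have := ler_norm B; lra.
Qed.

Lemma lin_shift f l : lin f -> lin (shift f l).
Proof.
move=> hf a x y; rewrite /shift hf scalerDr scalerBr opprD addrACA.
by rewrite !scalerA (mulrC l).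
Qed.

Lemma lin_iter f n : lin f -> lin (iter n f).
Proof. by move=> hf; elim: n => [//|n IH] a x y /=; rewrite IH hf. Qed.

Lemma shiftD f a b : shift (shift f a) b = shift f (a + b).
Proof. by apply/funext => x; rewrite /shift scalerDl opprD addrA. Qed.

Lemma shift0 f : shift f 0 = f.
Proof. by apply/funext => x; rewrite /shift scale0r subr0. Qed.

Lemma bop_shift M f l : bop M f -> bop M (shift f l).
Proof.
move=> [sM cM iM hf [B hB]]; split=> //; last 2 first.
- exact: lin_shift.
- exists (B + modc l) => x; apply: le_trans (nmB H _ _) _.
  by rewrite (nmZ H) mulrDl lerD2r.
by move=> x Mx; apply: subspB => //; [exact: iM|exact: subspZ].
Qed.

Lemma bop_iter M f n : bop M f -> bop M (iter n f).
Proof.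
move=> [sM cM iM hf [B hB]]; split=> //; last 2 first.
- exact: lin_iter.
- have [B' B0 hB'] := pos_bound hB; exists (B' ^+ n).
  elim: n => [|n IH] x /=; first by rewrite expr0 mul1r.
  by apply: le_trans (hB' _) _; rewrite exprS -mulrA ler_pM2l.
by elim: n => [//|n IH] x Mx /=; apply/iM/IH.
Qed.

Lemma ran_subsp M f : subsp M -> lin f -> subsp (ran_on M f).
Proof. by move=> hM hf; exact: subsp_image. Qed.

Lemma ker_subsp M f : subsp M -> lin f -> subsp (ker_on M f).
Proof.
move=> hM hf; split; first by split; [exact: subsp0|exact: lin0].
move=> a x y [Mx fx] [My fy]; split; first exact: hM.2.
by rewrite hf fx fy scaler0 addr0.
Qed.

Lemma ran_sub M f : (forall x, M x -> M (f x)) -> ran_on M f `<=` M.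
Proof. by move=> iM _ [x Mx <-]; exact: iM. Qed.

Lemma ker_sub M f : ker_on M f `<=` M.
Proof. by move=> x []. Qed.

Lemma ran_iter0 M f : ran_on M (iter 0 f) = M.
Proof. by apply/seteqP; split=> x; [move=> [y My <-]|move=> Mx; exists x]. Qed.

Lemma ran_iterS M f n : ran_on M (iter n.+1 f) = f @` ran_on M (iter n f).
Proof.
apply/seteqP; split=> x; first by move=> [y My <-]; exists (iter n f y) => //; exists y.
by move=> [_ [y My <-] <-]; exists y.
Qed.

Lemma ran_iter_dec M f n : (forall x, M x -> M (f x)) ->
  ran_on M (iter n.+1 f) `<=` ran_on M (iter n f).
Proof.
by move=> iM _ [x Mx <-]; exists (f x); [exact: iM|rewrite -iterSr].
Qed.

Lemma ran_iter_dec_le M f m n : (forall x, M x -> M (f x)) -> (m <= n)%N ->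
  ran_on M (iter n f) `<=` ran_on M (iter m f).
Proof.
move=> iM /subnKC <-; elim: (n - m)%N => [|k IH]; first by rewrite addn0.
by rewrite addnS; apply: subset_trans IH; exact: ran_iter_dec.
Qed.

(** Closed range made quantitative: the reduced minimum modulus of f|M is at least 1 / C. *)
Definition reg M f (C : R) :=
  forall x, M x -> exists x', [/\ M x', f x' = f x & nm x' <= C * nm (f x)].

Lemma closed_ran_reg M f : bop M f -> nclosed nm (ran_on M f) ->
  exists2 C, 0 < C & reg M f C.
Proof.
move=> [sM cM iM hf [B hB]] cR.
have [C C0 hC] := open_mapping H H hf hB sM cM cR.
by exists C => // x Mx; apply: hC; exists x.
Qed.

(** Preimages in Y of a convergent sequence need not converge. Replacing their increments by small
    vectors with the same image changes them only by kernel vectors, which lie in Y, and makes them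
    converge. *)
Lemma reg_closed_image M f C Y : bop M f -> reg M f C -> subsp Y ->
  Y `<=` M -> nclosed nm Y -> ker_on M f `<=` Y -> nclosed nm (f @` Y).
Proof.
move=> [sM cM iM hf [B hB]] hC sY YM cY kY y hy.
have [B' B0 hB'] := pos_bound hB.
have : forall n, exists p, Y p /\ nm (y - f p) <= 2^-1 ^+ n.
  move=> n; have [|_ [p Yp <-] yp] := hy (2^-1 ^+ n).
    by rewrite exprn_gt0// invr_gt0.
  by exists p; split=> //; exact: ltW.
move=> /choice[p hp].
have : forall n, exists z, [/\ M z, f z = f (p n.+1 - p n) & nm z <= `|C| * 2 * 2^-1 ^+ n].
  move=> n; have [Yn yn] := hp n; have [Yn1 yn1] := hp n.+1.
  have [|z [Mz fz nz]] := hC (p n.+1 - p n); first by apply: YM; exact: subspB.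
  exists z; split=> //; apply: le_trans nz _.
  apply: le_trans (_ : `|C| * nm (f (p n.+1 - p n)) <= _).
    by rewrite ler_wpM2r ?(nm_ge0 H) ?ler_norm.
  rewrite -mulrA ler_wpM2l// (linB hf).
  have := nm_tri H y (f (p n.+1)) (f (p n)); rewrite (nmBC H _ y).
  have : (0 : R) <= 2^-1 ^+ n by rewrite exprn_ge0// invr_ge0.
  by move: yn1; rewrite exprS; lra.
move=> /choice[z hz].
pose u := fix u n := if n is k.+1 then u k + z k else p 0%N.
have fu n : f (u n) = f (p n).
  elim: n => [//|n IH] /=; have [_ fz _] := hz n.
  by rewrite (linD hf) IH fz (linB hf) addrC subrK.
have Mu n : M (u n).
  elim: n => [|n IH] /=; first by apply: YM; have [] := hp 0%N.
  by apply: subspD => //; have [] := hz n.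
have Yu n : Y (u n).
  rewrite -(subrK (p n) (u n)); have [Yp _] := hp n; apply: subspD => //.
  apply: kY; split; first by apply: subspB => //; exact: YM.
  by rewrite (linB hf) fu subrr.
have [x hx] : exists x, forall n, nm (x - u n) <= 2 * (`|C| * 2) * 2^-1 ^+ n.
  apply: (geom_limit H) => n /=; rewrite addrC addKr.
  by have [] := hz n.
exists x.
  apply: cY => e e0; have [n hn] := half_small (2 * (`|C| * 2)) e0.
  by exists (u n) => //; apply: le_lt_trans (hx n) (hn n _).
apply/eqP; rewrite -subr_eq0; apply/eqP; apply: (nm_eq0_small H) => e e0.
have [n /(_ n (leqnn _)) hn] := half_small (B' * (2 * (`|C| * 2)) + 1) e0.
have := nm_tri H (f (p n)) (f x) y; rewrite -{1}fu -(linB hf) (nmBC H (f (p n)) y).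
have h1 := hB' (x - u n); have h2 := (hp n).2.
have h3 : B' * nm (x - u n) <= B' * (2 * (`|C| * 2) * 2^-1 ^+ n) by rewrite ler_pM2l.
lra.
Qed.

Lemma reg_closed M f C : bop M f -> reg M f C -> nclosed nm (ran_on M f).
Proof.
move=> bM hC; have [sM cM _ _ _] := bM.
apply: (reg_closed_image bM hC sM _ cM); [by move=> x|exact: (@ker_sub M f)].
Qed.

Lemma closed_image M f Y : bop M f -> nclosed nm (ran_on M f) -> subsp Y ->
  Y `<=` M -> nclosed nm Y -> ker_on M f `<=` Y -> nclosed nm (f @` Y).
Proof. by move=> bM /(closed_ran_reg bM)[C _ hC]; exact: (reg_closed_image bM hC). Qed.

Definition surj_on M f (C : R) :=
  forall y, M y -> exists x, [/\ M x, f x = y & nm x <= C * nm y].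

Lemma surj_onP M f : bop M f -> f @` M = M -> exists2 C, 0 < C & surj_on M f C.
Proof.
move=> bM e; have [|C C0 hC] := closed_ran_reg bM.
  by rewrite /ran_on e; have [] := bM.
exists C => // y; rewrite -{1}e => -[x Mx <-]; exact: hC.
Qed.

Lemma surj_perturb M f C l : bop M f -> surj_on M f C -> modc l * C <= 2^-1 ->
  surj_on M (shift f l) (2 * C).
Proof.
move=> bM hC lC; have [sM cM _ hs [B hB]] := bop_shift l bM.
apply: (approx_surj H H hs hB sM cM) => y My.
have [x [Mx fx nx]] := hC y My; exists x.
have -> : y - shift f l x = l *: x by rewrite /Defs.shift fx opprB addrC subrK.
split=> //; first exact: subspZ.
rewrite (nmZ H); have := ler_wpM2l (modc_ge0 l) nx.
by have := nm_ge0 H y; nra.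
Qed.

(** The hyperrange of f|M. *)
Definition core M f := [set x | forall n, ran_on M (iter n f) x].

(* For k = 0 this is the Kato condition; semi-Fredholm operators satisfy it
   for some k. *)
Definition ker_in_core M f k :=
  forall n, ker_on M f `&` ran_on M (iter k f) `<=` ran_on M (iter n f).

Definition closed_powers M f := forall n, nclosed nm (ran_on M (iter n f)).

Lemma core_sub M f : core M f `<=` M.
Proof. by move=> x /(_ 0%N); rewrite ran_iter0. Qed.

Lemma bop_core M f : bop M f -> closed_powers M f -> bop (core M f) f.
Proof.
move=> bM cP; have [sM cM iM hf hB] := bM; split=> //.
- split=> [n|a x y hx hy n].
    exact: subsp0 (ran_subsp sM (lin_iter n hf)).
  exact: (ran_subsp sM (lin_iter n hf)).2.
- move=> x hx n; apply: cP => e e0; have [y hy xy] := hx e e0.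
  by exists y => //; exact: hy.
- move=> x hx n; apply: (@ran_iter_dec M f n) => //.
  by rewrite ran_iterS; exists x => //; exact: hx.
Qed.

(** A preimage of a core element taken in ran f^k is already in the core: it differs from a preimage
    in any deeper range by an element of ker f n ran f^k, which lies in all ranges. *)
Lemma core_surj M f k : bop M f -> closed_powers M f -> ker_in_core M f k ->
  f @` core M f = core M f.
Proof.
move=> bM cP hk; have [_ _ iC _ _] := bop_core bM cP.
have [sM cM iM hf _] := bM.
apply/seteqP; split=> x; first by move=> [y Cy <-]; exact: iC.
move=> Cx; have := Cx k.+1; rewrite ran_iterS => -[y ky fy].
exists y => // n.
have [m nm_ km] : exists2 m, (n <= m)%N & (k <= m)%N.
  by exists (maxn n k); rewrite ?leq_maxl ?leq_maxr.
apply: (ran_iter_dec_le iM nm_).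
have := Cx m.+1; rewrite ran_iterS => -[z mz fz].
have sR j := ran_subsp sM (lin_iter j hf).
rewrite -(subrK z y); apply: (subspD (sR m)) => //; apply: hk; split; last first.
  apply: (subspB (sR k)) => //; exact: (ran_iter_dec_le iM km).
split; last by rewrite (linB hf) fy fz subrr.
by apply: subspB => //; [move: ky|move: mz] => [] [w Mw <-]; exact: (bop_inv (bop_iter _ bM)).
Qed.

Lemma kato_closed_powers M f : bop M f -> nclosed nm (ran_on M f) ->
  ker_in_core M f 0 -> closed_powers M f.
Proof.
move=> bM cR h0; have [sM cM iM hf _] := bM.
elim=> [|n IH]; first by rewrite ran_iter0.
rewrite ran_iterS; apply: (closed_image bM) => //.
- exact: ran_subsp (lin_iter n hf).
- exact: ran_sub (bop_inv (bop_iter n bM)).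
- by move=> x kx; apply: h0; split=> //; rewrite ran_iter0; case: kx.
Qed.

(** f maps the core onto itself, and modulo the core it is bounded below ([dist]), because the core
    contains the kernel. A preimage under f - l is controlled first modulo the core, then inside
    it. *)
Lemma kato_perturb M f : bop M f -> nclosed nm (ran_on M f) -> ker_in_core M f 0 ->
  exists e C, [/\ 0 < e, 0 < C & forall l, modc l < e ->
    reg M (shift f l) C /\ ker_in_core M (shift f l) 0].
Proof.
move=> bM cR h0; have cP := kato_closed_powers bM cR h0.
have bC := bop_core bM cP; have eC := core_surj bM cP h0.
have [C0 C00 hC0] := surj_onP bC eC.
have [C C1 hC] := closed_ran_reg bM cR.
have [sM cM iM hf [B0 hB0]] := bM; have [B B1 hB] := pos_bound hB0.
have [sC _ iC _ _] := bC.
have kC : ker_on M f `<=` core M f.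
  by move=> x kx n; apply: h0; split=> //; rewrite ran_iter0; case: kx.
have dist x m : M x -> core M f m ->
    exists2 m', core M f m' & nm (x - m') <= C * nm (f x - m).
  rewrite -{1}eC => Mx [m1 Cm1 <-].
  have [|z [Mz fz nz]] := hC (x - m1).
    by apply: subspB => //; exact: core_sub Cm1.
  exists (x - z); last by rewrite opprB addrC subrK -(linB hf).
  rewrite -(subrK m1 (x - z)); apply: (subspD sC) => //; apply: kC; split.
    by rewrite addrAC; apply: subspB => //; apply: subspB => //; exact: core_sub Cm1.
  by rewrite addrAC (linB hf) fz subrr.
(* Both contractions, modulo the core (constant C) and inside it (constant C0), need a factor of at
   most 1/2. *)
pose e := Num.min (2^-1 / C) (2^-1 / C0).
have e0 : 0 < e by rewrite lt_min !divr_gt0.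
have eC1 : e * C <= 2^-1.
  by rewrite -ler_pdivlMr// ge_min lexx.
have eC2 : e * C0 <= 2^-1.
  by rewrite -ler_pdivlMr// ge_min lexx orbT.
(* 3 C bounds the distance from x to m in the core; [2 * C0] is the cost of solving in the core for
   [shift f l m], whose norm is at most [1 + (B + e) * (3 * C)] times that of y. *)
pose D := 3 * C + 2 * C0 * (1 + (B + e) * (3 * C)).
have D0 : 0 < D by rewrite addr_gt0// !mulr_gt0// addr_gt0// !mulr_gt0// addr_gt0.
exists e, D; split=> // l le.
have hS : surj_on (core M f) (shift f l) (2 * C0).
  apply: (surj_perturb bC hC0); apply: le_trans eC2; rewrite ler_pM2r//; exact: ltW.
have lC : modc l * C <= 2^-1.
  by apply: le_trans eC1; rewrite ler_pM2r//; exact: ltW.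
have hs := lin_shift l hf; have is_ := bop_inv (bop_shift l bM).
split; last first.
  move=> n x [[Mx kx] _].
  have Cx : core M f x.
    (* For l <> 0 an eigenvector equals f^j (l^-j x) and so lies in every range of f. Once x is in
       the core, surjectivity of f - l there puts it in every range of f - l. *)
    have [l0|l0] := eqVneq l 0.
      by apply: kC; split=> //; move: kx; rewrite l0 shift0.
    move=> j; have fx : f x = l *: x by apply/eqP; rewrite -subr_eq0; apply/eqP.
    exists (l^-1 ^+ j *: x); first exact: subspZ.
    rewrite (linZ (lin_iter j hf)).
    have -> : iter j f x = l ^+ j *: x.
      elim: j => [|j IH] /=; first by rewrite expr0 scale1r.
      by rewrite IH (linZ hf) fx scalerA exprSr.
    by rewrite scalerA -exprMn mulVf// expr1n scale1r.
  elim: n x {Mx kx} Cx => [|n IH] x Cx; first by rewrite ran_iter0; exact: core_sub Cx.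
  have [x' [Cx' <- _]] := hS x Cx.
  rewrite ran_iterS; exists x' => //; exact: IH.
move=> x Mx; set y := shift f l x.
have fE : f x = y + l *: x by rewrite /y /Defs.shift subrK.
have [y0|y0] := EM (y = 0).
  exists 0; rewrite y0 (lin0 hs) (nm0 H) mulr0; split=> //; exact: subsp0.
have yp := nm_gt0 H y0.
have Cy : 0 < C * nm y by rewrite mulr_gt0.
(* As f x = y + l x, the distance estimate at l m yields m' with |x - m'| <= C |y| + |x - m| / 2. *)
have [||m Cm nm_] := @iter_half R X (core M f) (fun m => nm (x - m)) _ Cy.
- by exists 0; exact: subsp0.
- move=> m Cm; have [m' Cm' h] := dist x (l *: m) Mx (subspZ sC l Cm).
  exists m' => //; apply: le_trans h _.
  rewrite fE -addrA -scalerBr.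
  have := nmD H y (l *: (x - m)); rewrite (nmZ H) => h.
  have h1 : modc l * C * nm (x - m) <= 2^-1 * nm (x - m).
    by rewrite ler_wpM2r ?(nm_ge0 H).
  have := ler_wpM2l (ltW C1) h; lra.
have Csm : core M f (shift f l m).
  by apply: (subspB sC); [exact: iC|exact: (subspZ sC)].
have [m' [Cm' em' nm']] := hS _ Csm.
exists (x - m + m'); split.
- apply: subspD => //; last exact: core_sub Cm'.
  by apply: subspB => //; exact: core_sub Cm.
- by rewrite (linD hs) (linB hs) em' subrK.
apply: le_trans (nmD H _ _) _.
have h1 : nm (shift f l m) <= nm y + (B + e) * (3 * (C * nm y)).
  have -> : shift f l m = y - shift f l (x - m).
    by rewrite (linB hs) opprB addrC subrK.
  apply: le_trans (nmB H _ _) _; rewrite lerD2l.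
  apply: le_trans (nmB H _ _) _; rewrite (nmZ H) mulrDl.
  apply: lerD.
    by apply: le_trans (hB _) _; rewrite ler_pM2l.
  by apply: ler_pM => //; rewrite ?modc_ge0 ?(nm_ge0 H)// ltW.
have h2 : nm m' <= 2 * C0 * (nm y + (B + e) * (3 * (C * nm y))).
  by apply: le_trans nm' _; rewrite ler_pM2l// mulr_gt0.
rewrite /D; lra.
Qed.

(** On a kernel vector z of f - l the operator f - (l + d) takes the value - d z; subtracting a
    small solution of the same value lands in the new kernel. *)
Lemma gap_shift_ker M f C l d : bop M f -> reg M (shift f (l + d)) C ->
  gap nm (ker_on M (shift f l)) (ker_on M (shift f (l + d))) (C * modc d).
Proof.
move=> bM hC z [Mz kz]; have hs := lin_shift (l + d) (bop_lin bM).
have [x [Mx ex nx]] := hC z Mz.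
exists (z - x); last first.
  rewrite opprB addrC subrK; apply: le_trans nx _.
  by rewrite -shiftD {1}/Defs.shift kz sub0r (nmN H) (nmZ H) mulrA.
split; first by apply: subspB => //; exact: bop_sub bM.
by rewrite (linB hs) ex subrr.
Qed.

Lemma gap_shift_ran M f C l d : bop M f -> reg M (shift f (l + d)) C ->
  gap nm (ran_on M (shift f (l + d))) (ran_on M (shift f l)) (C * modc d).
Proof.
move=> bM hC _ [x0 Mx0 <-].
have [x [Mx <- nx]] := hC x0 Mx0.
exists (shift f l x); first by exists x.
rewrite -shiftD {1}/Defs.shift addrAC subrr sub0r (nmN H) (nmZ H).
rewrite -mulrA mulrCA ler_wpM2l ?modc_ge0//.
by move: nx; rewrite -!shiftD.
Qed.

(** Gap estimates give one inequality per step; since C is the same at both ends, each step can be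
    reversed, which gives equality. *)
Lemma kato_dims M f e C : bop M f -> 0 < C ->
  (forall l, modc l < e -> reg M (shift f l) C) ->
  forall l m, modc l < e ->
  (dim_ge (ker_on M (shift f l)) [set 0] m <-> dim_ge (ker_on M f) [set 0] m) /\
  (dim_ge M (ran_on M (shift f l)) m <-> dim_ge M (ran_on M f) m).
Proof.
move=> bM C0 hC l m le; have [th th0 hth] := dim_ge_gap H m.
have [sM cM iM hf _] := bM.
have sK a := ker_subsp sM (lin_shift a hf).
have sR a := ran_subsp sM (lin_shift a hf).
have s0 := @subsp_set0 _ X.
have K0 a : [set 0] `<=` ker_on M (shift f a) by move=> _ ->; exact: subsp0.
have c0 : nclosed nm [set 0].
  move=> x hx; apply: (nm_eq0_small H) => d d0.
  by have [_ -> ] := hx d d0; rewrite subr0 => /ltW.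
have g0 : gap nm [set 0] [set 0] th.
  by move=> _ ->; exists 0 => //; rewrite subrr (nm0 H) mulr0.
have gM : gap nm M M th.
  by move=> x Mx; exists x => //; rewrite subrr (nm0 H) mulr_ge0 ?(nm_ge0 H)// ltW.
have gle Y Z t : t <= th -> gap nm Y Z t -> gap nm Y Z th.
  move=> tt g y Yy; have [z Zz yz] := g y Yy; exists z => //.
  by apply: le_trans yz _; rewrite ler_wpM2r ?(nm_ge0 H).
have rM a : ran_on M (shift f a) `<=` M := ran_sub (bop_inv (bop_shift a bM)).
have step a d : modc a < e -> modc (a + d) < e -> C * modc d <= th ->
    (dim_ge (ker_on M (shift f a)) [set 0] m -> dim_ge (ker_on M (shift f (a + d))) [set 0] m) /\
    (dim_ge M (ran_on M (shift f a)) m -> dim_ge M (ran_on M (shift f (a + d))) m).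
  move=> ae ade Cd; split.
    apply: hth => //; apply: gle Cd _; exact: gap_shift_ker (hC _ ade).
  apply: hth => //; first exact: reg_closed (bop_shift a bM) (hC _ ae).
  apply: gle Cd _; exact: gap_shift_ran (hC _ ade).
have iff a d : modc a < e -> modc (a + d) < e -> C * modc d <= th ->
    (dim_ge (ker_on M (shift f (a + d))) [set 0] m <-> dim_ge (ker_on M (shift f a)) [set 0] m) /\
    (dim_ge M (ran_on M (shift f (a + d))) m <-> dim_ge M (ran_on M (shift f a)) m).
  move=> ae ade Cd; have [s1 s2] := step a d ae ade Cd.
  by have := step (a + d) (- d); rewrite addrK modcN => /(_ ade ae Cd)[s3 s4].
(* [C] is uniform on the disc, so finitely many steps of size [C |d| <= th] lead
   from [0] to [l]. *)
pose n := Num.Def.archi_bound (C * modc l / th).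
have n0 : (0 : R) < n%:R.
  apply: le_lt_trans (archi_boundP _); rewrite divr_ge0 ?mulr_ge0 ?modc_ge0// ltW//.
pose d := rc n%:R^-1 * l.
have nd : modc d = n%:R^-1 * modc l by rewrite modcM modc_rc gtr0_norm ?invr_gt0.
have Cd : C * modc d <= th.
  rewrite nd mulrCA ler_pdivrMl// ltW// -ltr_pdivrMr//; apply: archi_boundP.
  by rewrite divr_ge0 ?mulr_ge0 ?modc_ge0// ltW.
have small k : (k <= n)%N -> modc (rc k%:R * d) < e.
  move=> kn; apply: le_lt_trans le; rewrite modcM modc_rc nd ger0_norm// mulrA.
  by rewrite ler_piMl ?modc_ge0// ler_pdivrMr// mul1r ler_nat.
have : forall k, (k <= n)%N ->
  (dim_ge (ker_on M (shift f (rc k%:R * d))) [set 0] m <-> dim_ge (ker_on M f) [set 0] m) /\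
  (dim_ge M (ran_on M (shift f (rc k%:R * d))) m <-> dim_ge M (ran_on M f) m).
  elim=> [_|k IH kn]; first by rewrite (_ : rc 0 = 0)// mul0r shift0.
  have e1 : rc k.+1%:R * d = rc k%:R * d + d.
    by rewrite -natr1 rcD mulrDl mul1r.
  have [i1 i2] := IH (ltnW kn).
  have [|||j1 j2] := iff (rc k%:R * d) d.
  - exact: small (ltnW kn).
  - by rewrite -e1; exact: small.
  - exact: Cd.
  by rewrite e1 j1 j2.
move=> /(_ n (leqnn n)).
by rewrite /d mulrA -rcM mulfV ?gt_eqF// mul1r.
Qed.

End Operators.

(** * Browder and Riesz operators *)

Section Browder.
Variables (R : realType) (X : completeNormedModType (Cplx R)).
Local Notation nm := (@nm R X).
Local Notation H := (nm_banach X).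
Local Notation shift := Defs.shift.
Implicit Types (M N Y : set X) (f : X -> X) (l : Cplx R).

Definition browder N f p :=
  ker_on N (iter p f) = ker_on N (iter p.+1 f) /\
  ran_on N (iter p f) = ran_on N (iter p.+1 f).

Definition bij_on N f := (forall x, N x -> f x = 0 -> x = 0) /\ f @` N = N.

Definition semi_fredholm N f :=
  (qfin (ker_on N f) [set 0] /\ nclosed nm (ran_on N f)) \/
  qfin N (ran_on N f).

Lemma shift_iterC f l k x : lin f ->
  shift f l (iter k f x) = iter k f (shift f l x).
Proof.
by move=> hf; rewrite /Defs.shift (linB (lin_iter k hf)) (linZ (lin_iter k hf)) -iterSr.
Qed.

Lemma ker_iter_inc N f n : lin f -> ker_on N (iter n f) `<=` ker_on N (iter n.+1 f).
Proof. by move=> hf x [Nx kx]; split=> //=; rewrite kx (lin0 hf). Qed.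

Lemma browder_ker N f p j : (forall x, N x -> N (f x)) ->
  ker_on N (iter p f) = ker_on N (iter p.+1 f) ->
  ker_on N (iter (p + j) f) = ker_on N (iter p f).
Proof.
move=> iN e; elim: j => [|j IH]; first by rewrite addn0.
rewrite -IH addnS; apply/seteqP; split=> x [Nx kx].
  have : ker_on N (iter p.+1 f) (iter j f x).
    split; last by rewrite -iterD addSn.
    by elim: (j) => [//|i] /=; exact: iN.
  by rewrite -e => -[_ h]; split=> //; rewrite iterD.
have : ker_on N (iter p f) (iter j f x).
  split; last by rewrite -iterD.
  by elim: (j) => [//|i] /=; exact: iN.
by rewrite e => -[_ h]; split=> //; rewrite -addSn iterD.
Qed.

(** Ascent: a nonzero kernel vector z in the core would give f - l, for small l, a second and
    shorter solution x of (f - l) x = - l z, against injectivity. Descent: f is bounded below on ran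
    f^k, so the solutions x1 of (f - l) x1 = y stay bounded as l tends to 0, and f x1 tends to y. *)
Lemma limit_bij_browder N f k : bop N f -> closed_powers N f -> ker_in_core N f k ->
  (forall d, 0 < d -> exists2 l, modc l < d & bij_on N (shift f l)) ->
  browder N f k.
Proof.
move=> bN cP hk near; have bC := bop_core bN cP; have eC := core_surj bN cP hk.
have [C0 C00 hC0] := surj_onP bC eC.
have [sN cN iN hf [B0 hB0]] := bN.
have inj z : core N f z -> f z = 0 -> z = 0.
  move=> Cz fz; apply: contrapT => z0; have nz := nm_gt0 H z0.
  have d0 : 0 < 4^-1 / C0 by rewrite divr_gt0.
  have [l ld [linj _]] := near _ d0.
  rewrite ltr_pdivlMr// in ld.
  have lC : modc l * C0 <= 2^-1 by lra.
  have [x [Cx ex nx]] := surj_perturb bC hC0 lC (bop_inv (bop_shift l bC) Cz).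
  have zx : z - x = 0.
    apply: linj; first by apply: (subspB sN); exact: core_sub.
    by rewrite (linB (lin_shift l hf)) ex subrr.
  move: nx; rewrite /Defs.shift fz sub0r (nmN H) (nmZ H) -(subr0_eq zx).
  have : modc l * C0 * nm z < 4^-1 * nm z by rewrite ltr_pM2r.
  by lra.
have kerk x : N x -> ker_on N f (iter k f x) -> iter k f x = 0.
  move=> Nx [Nf kf]; apply: inj => // n; apply: hk; split=> //.
  by exists x.
split; apply/seteqP; split=> x.
- exact: ker_iter_inc.
- move=> [Nx kx]; split=> //; apply: kerk => //; split=> //.
  exact: (bop_inv (bop_iter k bN)).
- move=> [w Nw <-]; apply: (cP k.+1) => e e0.
  set y := iter k f w.
  have bR : bop (ran_on N (iter k f)) f.
    split; [exact: ran_subsp (lin_iter k hf)|exact: (cP k)| |by []|by exists B0].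
    by move=> _ [z Nz <-]; exists (f z); [exact: iN|rewrite -iterSr].
  have [|C C1 hC] := closed_ran_reg bR; first by rewrite /ran_on -ran_iterS; exact: cP.
  have bnd x1 : ran_on N (iter k f) x1 -> nm x1 <= C * nm (f x1).
    move=> Rx; have [x' [Rx' fx' nx']] := hC x1 Rx.
    have x'x : x' - x1 = 0.
      have [a Na ea] := subspB (bop_sub bR) Rx' Rx.
      rewrite -ea; apply: kerk => //; rewrite ea; split.
        by apply: (subspB sN); [move: Rx'|move: Rx] => -[b Nb <-]; exact: (bop_inv (bop_iter k bN)).
      by rewrite (linB hf) fx' subrr.
    by rewrite -(subr0_eq x'x) fx'.
  (* The first bound gives |x1| <= 2 C |y|, the second then |l x1| < e; adding 1 to [nm y] avoids a
     zero denominator. *)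
  pose d := Num.min (2^-1 / C) (e / (2 * C * (nm y + 1))).
  have y1 : 0 < nm y + 1 by have := nm_ge0 H y; lra.
  have d0 : 0 < d by rewrite lt_min !divr_gt0// !mulr_gt0.
  have d1 : d * C <= 2^-1 by rewrite -ler_pdivlMr// ge_min lexx.
  have d2 : d * (2 * C * (nm y + 1)) <= e.
    by rewrite -ler_pdivlMr ?mulr_gt0// ge_min lexx orbT.
  have [l ld [_ ls]] := near d d0.
  have : N w by []; rewrite -{1}ls => -[w' Nw' ew'].
  pose x1 := iter k f w'.
  have ex1 : shift f l x1 = y by rewrite /x1 shift_iterC// ew'.
  have Rx1 : ran_on N (iter k f) x1 by exists w'.
  exists (f x1); first by rewrite ran_iterS; exists x1.
  have fx1 : f x1 = y + l *: x1 by rewrite -ex1 /Defs.shift subrK.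
  rewrite (nmBC H) fx1 addrC addKr (nmZ H).
  have b1 := bnd _ Rx1; rewrite fx1 in b1.
  have b2 := nmD H y (l *: x1); rewrite (nmZ H) in b2.
  have m0 := modc_ge0 l; have n0 := nm_ge0 H x1.
  have b3 : modc l * C * nm x1 <= 2^-1 * nm x1.
    rewrite ler_wpM2r//; apply: le_trans d1; rewrite ler_pM2r//; exact: ltW.
  have b4 : C * nm (y + l *: x1) <= C * (nm y + modc l * nm x1) by rewrite ler_pM2l.
  have b5 : nm x1 <= 2 * C * nm y by lra.
  have b6 : modc l * nm x1 <= d * (2 * C * nm y) by apply: ler_pM => //; exact: ltW.
  have b7 : 0 < d * C by rewrite mulr_gt0.
  by lra.
- by move=> [w Nw <-]; exists (f w); [exact: iN|rewrite -iterSr].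
Qed.

(** N is the sum of ker f^p and ran f^p. On the first f is nilpotent, so f - l is onto it for every
    l <> 0; on the second f is bijective, so f - l is onto it for small l. *)
Lemma browder_open N f p : bop N f -> browder N f p ->
  nclosed nm (ran_on N (iter p f)) ->
  exists2 d, 0 < d & forall l, l != 0 -> modc l < d -> bij_on N (shift f l).
Proof.
move=> bN [ek er] cR; have [sN cN iN hf hB] := bN.
have bR : bop (ran_on N (iter p f)) f.
  split; [exact: ran_subsp (lin_iter p hf)|by []| |by []|by []].
  by move=> _ [z Nz <-]; exists (f z); [exact: iN|rewrite -iterSr].
have eR : f @` ran_on N (iter p f) = ran_on N (iter p f).
  by rewrite -ran_iterS -er.
have iterN x j : N x -> N (iter j f x) by exact: (bop_inv (bop_iter j bN)).
have injR z : ran_on N (iter p f) z -> f z = 0 -> z = 0.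
  move=> [x Nx <-] fx; have : ker_on N (iter p.+1 f) x by [].
  by rewrite -ek => -[].
have [C C0 hC] := surj_onP bR eR.
have bnd x1 : ran_on N (iter p f) x1 -> nm x1 <= C * nm (f x1).
  move=> Rx; have [x' [Rx' fx' nx']] := hC (f x1) (bop_inv bR Rx).
  have x'x : x' - x1 = 0.
    apply: injR; first exact: (subspB (bop_sub bR)).
    by rewrite (linB hf) fx' subrr.
  by rewrite -(subr0_eq x'x) fx'.
exists (2^-1 / C); first by rewrite divr_gt0.
move=> l l0; rewrite ltr_pdivlMr// => lC.
have hs := lin_shift l hf; have is_ := bop_inv (bop_shift l bN).
have hS := surj_perturb bR hC (ltW lC).
split.
  move=> x Nx kx.
  have fx : f x = l *: x by apply/eqP; rewrite -subr_eq0; apply/eqP.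
  have ix j : iter j f x = l ^+ j *: x.
    elim: j => [|j IH] /=; first by rewrite expr0 scale1r.
    by rewrite IH (linZ hf) fx scalerA exprSr.
  have Rx : ran_on N (iter p f) x.
    exists (l^-1 ^+ p *: x); first exact: subspZ.
    by rewrite (linZ (lin_iter p hf)) ix scalerA -exprMn mulVf// expr1n scale1r.
  apply: contrapT => /(nm_gt0 H) nx; have := bnd x Rx.
  by rewrite fx (nmZ H); nra.
apply/seteqP; split=> y; first by move=> [x Nx <-]; exact: is_.
move=> Ny.
(* If (f - l) x = f u, then (x - u) / l solves the equation for u; f u is killed by one power
   less. *)
have nil j u : N u -> iter j f u = 0 -> exists2 x, N x & shift f l x = u.
  elim: j u => [|j IH] u Nu /= ju.
    by exists 0; [exact: subsp0|rewrite ju (lin0 hs)].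
  have [|x Nx ex] := IH (f u) (iN _ Nu); first by rewrite -iterSr.
  exists (l^-1 *: (x - u)); first by apply: subspZ => //; exact: subspB.
  by rewrite (linZ hs) (linB hs) ex /Defs.shift opprB addrC subrK scalerA mulVf// scale1r.
have ranN z : ran_on N (iter p f) z -> N z by move=> [x Nx <-]; exact: iterN.
have [w [Nw ew]] : exists w, ran_on N (iter p f) w /\ iter p f w = iter p f y.
  have surj j z : ran_on N (iter p f) z -> exists w, ran_on N (iter p f) w /\ iter j f w = z.
    elim: j z => [|j IH] z Rz; first by exists z.
    have [w1 [Rw1 <-]] := IH z Rz.
    have [w [Rw <- _]] := hC w1 Rw1.
    by exists w; rewrite iterSr.
  by apply: surj; exists y.
have [x1 Nx1 ex1] : exists2 x, N x & shift f l x = y - w.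
  apply: (nil p); first by apply: subspB => //; exact: ranN.
  by rewrite (linB (lin_iter p hf)) ew subrr.
have [x2 [Rx2 ex2 _]] := hS w Nw.
exists (x1 + x2); first by apply: subspD => //; exact: ranN.
by rewrite (linD hs) ex1 ex2 subrK.
Qed.

(** f^n maps N / ran f onto ran f^n / ran f^(n+1), so every step of the chain has finite
    codimension. *)
Lemma ran_iter_qfin N f : bop N f -> qfin N (ran_on N f) ->
  forall n, qfin N (ran_on N (iter n f)).
Proof.
move=> [sN cN iN hf hB] [m qm]; elim=> [|n [a qa]].
  by rewrite ran_iter0; exists 0%N; exact: qdim_refl.
have sR j := ran_subsp sN (lin_iter j hf).
have hn := lin_iter n hf.
have sI : ran_on N f `<=` N `&` iter n f @^-1` ran_on N (iter n.+1 f).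
  by move=> _ [x Nx <-]; split; [exact: iN|exists x => //; rewrite -iterSr].
have sP : subsp (N `&` iter n f @^-1` ran_on N (iter n.+1 f)).
  split; first by split; [exact: subsp0|rewrite /= (lin0 hn); exact: subsp0].
  move=> b x y [Nx Rx] [Ny Ry]; split; first exact: sN.2.
  by rewrite /= hn; apply: (sR n.+1).2.
have [_ [b [_ qb _]]] := qdim_split (ran_subsp sN hf) sP sI (@subIsetl _ _ _) qm.
exists (b + a)%N; apply: qdim_add qa.
apply: (qdim_image hn) qb => //.
- exact: ran_iter_dec.
- by move=> _ [x Nx <-]; exists x, 0; rewrite addr0; split=> //; exact: subsp0.
Qed.

(** The index k is where a monotone chain stops: ker f n ran f^k decreases when the kernel is
    finite-dimensional, ran f + ker f^k increases when the range has finite codimension. *)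
Lemma semi_fredholm_powers N f : bop N f -> semi_fredholm N f ->
  closed_powers N f /\ exists k, ker_in_core N f k.
Proof.
move=> bN sf; have [sN cN iN hf [B hB]] := bN.
have sR j := ran_subsp sN (lin_iter j hf).
have sK := ker_subsp sN hf.
have iterN x j : N x -> N (iter j f x) by exact: (bop_inv (bop_iter j bN)).
have RN j : ran_on N (iter j f) `<=` N by exact: ran_sub (bop_inv (bop_iter j bN)).
have dec m n := @ran_iter_dec_le _ _ N f m n iN.
case: sf => [[[m qm] cR]|fin]; split.
- elim=> [|n IH]; first by rewrite ran_iter0.
  have [s [sm is_ es]] := qm.
  have sk v : v \in s -> ker_on N f v.
    by move=> vs; rewrite -es; apply: mem_spn => //; exact: subsp_set0.
  (* Adding the kernel to ran f^n does not change its image, and a closed image needs a subspace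
     containing the kernel. *)
  have e : f @` spn (ran_on N (iter n f)) s = f @` ran_on N (iter n f).
    apply/seteqP; split=> y; last first.
      by move=> [x Rx <-]; exists x => //; exact: sub_spn.
    move=> [x hx <-]; move: x hx.
    apply: (@spn_sub _ _ (ran_on N (iter n f)) (f @^-1` (f @` ran_on N (iter n f))) s).
    + split; first by exists 0 => //; exact: subsp0.
      move=> a x z [u Ru eu] [v Rv ev]; exists (a *: u + v); first exact: (sR n).2.
      by rewrite !hf eu ev.
    + by move=> x Rx; exists x.
    + by move=> v /sk[Nv kv]; exists 0; [exact: subsp0|rewrite (lin0 hf) kv].
  rewrite ran_iterS -e; apply: (closed_image bN cR).
  + exact: spn_subsp.
  + by apply: spn_sub => // v /sk[].
  + exact: (spn_closed H).
  + by rewrite -es; apply: spn_mono => _ ->; exact: subsp0.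
- pose Z k := ker_on N f `&` ran_on N (iter k f).
  have sZ k : subsp (Z k).
    split; first by split; exact: subsp0.
    by move=> a x y [kx Rx] [ky Ry]; split; [exact: sK.2|exact: (sR k).2].
  have [|||k hk] := decreasing_stationary (@subsp_set0 _ X) sZ.
  + by move=> k _ ->; exact: subsp0.
  + by move=> k x [kx Rx]; split=> //; exact: (dec k k.+1).
  + have -> : Z 0%N = ker_on N f; last by exists m.
    by apply/seteqP; split=> x; [case|move=> kx; split=> //; rewrite ran_iter0; case: kx].
  exists k => n x hx; have [kn|/ltnW nk] := leqP k n; last by apply: dec hx.2.
  by have : Z k x by []; rewrite -(hk n kn) => -[].
- move=> n; have [a [s [_ _ es]]] := ran_iter_qfin bN fin n.
  have [_ _ _ hn [Bn hBn]] := bop_iter n bN.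
  apply: (@closed_range_of_spn _ _ _ s H _ _ _ _ _ H hn hBn sN cN).
  by rewrite -/(ran_on N (iter n f)) es.
- (* [Y n] is ran f + ker f^n. *)
  pose Y n := N `&` iter n f @^-1` ran_on N (iter n.+1 f).
  have sY n : subsp (Y n).
    have hn := lin_iter n hf.
    split; first by split; [exact: subsp0|rewrite /= (lin0 hn); exact: subsp0].
    move=> b x y [Nx Rx] [Ny Ry]; split; first exact: sN.2.
    by rewrite /= hn; apply: (sR n.+1).2.
  have YS n : Y n `<=` Y n.+1.
    move=> x [Nx [z Nz ez]]; split=> //; exists z => //=.
    by move: ez => /= ->.
  have [|||k hk] := increasing_stationary sN sY.
  + by move=> k x [].
  + exact: YS.
  + have [m qm] := fin; have sY0 : ran_on N f `<=` Y 0%N.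
      by move=> _ [x Nx <-]; split; [exact: iN|exists x].
    have [_ [b [_ qb _]]] := qdim_split (sR 1%N) (sY 0%N) sY0 (@subIsetl _ _ _) qm.
    by exists b.
  exists k => n x [kx Rx]; have [nk|/ltnW] := leqP n k; first exact: dec Rx.
  move=> /subnKC <-; elim: (n - k)%N => [|j IH]; first by rewrite addn0.
  have [z Nz ez] := IH.
  (* Since f x = 0, z is in [Y (k + j).+1], which equals [Y (k + j)]; hence x = f^(k+j) z lies one
     range deeper. *)
  have : Y (k + j).+1 z.
    split=> //; rewrite /= ez; case: kx => _ ->; exact: (subsp0 (sR (k + j).+2)).
  rewrite hk; last by rewrite -addnS leq_addr.
  by rewrite -(hk (k + j)%N (leq_addr _ _)) addnS => -[_]; rewrite /= ez.
Qed.

(** f is nilpotent on F = ker f^p and bijective on W = ran f^p, with N = F + W direct. Either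
    finiteness hypothesis makes F finite-dimensional, and there rank-nullity gives index 0. *)
Lemma browder_index N f p : bop N f -> browder N f p ->
  qfin (ker_on N f) [set 0] \/ qfin N (ran_on N f) ->
  exists n, qdim (ker_on N f) [set 0] n /\ qdim N (ran_on N f) n.
Proof.
move=> bN [ek er] fin; have [sN cN iN hf hB] := bN.
have s0 := @subsp_set0 _ X.
have hp := lin_iter p hf.
have sR j := ran_subsp sN (lin_iter j hf).
have sK j := ker_subsp sN (lin_iter j hf).
have iterN x j : N x -> N (iter j f x) by exact: (bop_inv (bop_iter j bN)).
set F := ker_on N (iter p f); set W := ran_on N (iter p f).
have eW : f @` W = W by rewrite /W -ran_iterS -er.
have iF x : F x -> F (f x).
  move=> [Nx kx]; split; [exact: iN|rewrite -iterSr /= kx (lin0 hf)//].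
have FN : F `<=` N := @ker_sub _ _ N _.
have WN : W `<=` N by exact: ran_sub (bop_inv (bop_iter p bN)).
have decomp y : N y -> exists x w, [/\ F x, W w & y = x + w].
  move=> Ny.
  have [w [Rw ew]] : exists w, W w /\ iter p f w = iter p f y.
    have surj j z : W z -> exists w, W w /\ iter j f w = z.
      elim: j z => [|j IH] z Rz; first by exists z.
      have [w1 [Rw1 <-]] := IH z Rz.
      move: Rw1; rewrite -{1}eW => -[w Rw <-].
      by exists w; rewrite iterSr.
    by apply: surj; exists y.
  exists (y - w), w; rewrite subrK; split=> //; split.
    by apply: subspB => //; exact: WN.
  by rewrite (linB hp) ew subrr.
have FW x : F x -> W x -> x = 0.
  move=> [Nx kx] [z Nz ez]; have : ker_on N (iter (p + p) f) z.
    by split=> //; rewrite iterD ez.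
  by rewrite (browder_ker _ iN ek) => -[_]; rewrite ez.
have k0F : ker_on N f `<=` F.
  move=> x [Nx kx]; rewrite /F -(browder_ker 1 iN ek) addn1.
  by split=> //; rewrite iterSr kx (lin0 hp).
have finF : qfin F [set 0].
  case: fin => [[m qm]|fin].
    have : forall j, qfin (ker_on N (iter j f)) [set 0].
      elim=> [|j [a qa]].
        exists 0%N; have -> : ker_on N (iter 0 f) = [set 0]; last exact: qdim_refl.
        by apply/seteqP; split=> x; [case|move=> ->; exact: subsp0].
      have [b qb] : qfin (ker_on N (iter j.+1 f)) (ker_on N (iter j.+1 f) `&` f @^-1` [set 0]).
        apply: (@qfin_image_inv _ _ _ f hf _ _ (ker_on N (iter j f))) => //.
          by move=> _ [x [Nx kx] <-]; split; [exact: iN|rewrite -iterSr].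
        by exists a.
      exists (m + b)%N; apply: qdim_add qm _.
      have -> : ker_on N f = ker_on N (iter j.+1 f) `&` f @^-1` [set 0]; last by [].
      apply/seteqP; split=> x; last by move=> [[Nx _] kx].
      by move=> [Nx kx]; split=> //; split=> //; rewrite iterSr kx (lin0 (lin_iter j hf)).
    exact.
  (* F meets W only in 0, so it embeds into the finite-dimensional N / W. *)
  have [m qm] := ran_iter_qfin bN fin p.
  have -> : [set 0] = F `&` id @^-1` W.
    apply/seteqP; split=> x; last by move=> [Fx Wx]; exact: FW.
    by move=> ->; split; [exact: (subsp0 (sK p))|exact: (subsp0 (sR p))].
  apply: (@qfin_image_inv _ _ _ id _ _ _ N); [by []|exact: sK|exact: sR| |by exists m].
  by move=> _ [x Fx <-]; exact: FN.
have [nF qF] := finF.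
have sF : subsp F := sK p.
have sfF : subsp (f @` F) := subsp_image hf sF.
have fFF : f @` F `<=` F by move=> _ [x Fx <-]; exact: iF.
have z0 : [set 0] `<=` ker_on N f by move=> _ ->; exact: subsp0 (ker_subsp sN hf).
have z1 : [set 0] `<=` f @` F by move=> _ ->; exact: subsp0 sfF.
(* F / ker f and f(F) have the same dimension, hence so do ker f and F / f(F); the latter is N / ran
   f because W = f(W). *)
have [n [r [qn qr e1]]] := qdim_split s0 (ker_subsp sN hf) z0 k0F qF.
have [r' [d [qr' qd e2]]] := qdim_split s0 sfF z1 fFF qF.
have rr : r = r'.
  apply: (qdim_uniq s0) qr'; apply: (@qdim_image _ _ _ f hf F) => //.
    by move=> y [x Fx <-]; exists x, 0; rewrite addr0.
  have -> // : F `&` f @^-1` [set 0] = ker_on N f.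
  by apply/seteqP; split=> x; [move=> [[]]|move=> kx; split; [exact: k0F|case: kx]].
have nd : n = d by apply: (@addIn r); rewrite -e1 rr addnC -e2.
exists n; split=> //; rewrite nd.
apply: (@qdim_image _ _ _ id _ F) => //.
- exact: (sR 1%N).
- exact: ran_sub.
- by move=> _ [x Fx <-]; exact: FN.
- move=> y /decomp[x [w [Fx Ww ->]]]; exists x, w; split=> //.
  move: Ww; rewrite -eW => -[v Wv <-]; exists v => //; exact: WN.
have -> // : F `&` id @^-1` ran_on N f = f @` F.
apply/seteqP; split=> x; last first.
  by move=> [z Fz <-]; split; [exact: iF|exists z => //; exact: FN].
move=> [[_ kx] [z Nz ez]]; exists z => //.
rewrite /F -(browder_ker 1 iN ek) addn1; split=> //.
by rewrite iterSr ez.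
Qed.

(** * Riesz operators: bijectivity near every point *)

Section Riesz.
Variables (N : set X) (V : X -> X).
Hypotheses (bN : bop N V) (rV : forall l, l != 0 -> semi_fredholm N (shift V l)).

(** l is in the closure of the resolvent set of V on N. Unlike bijectivity this passes to limits, so
    it can cross eigenvalues along a ray. *)
Definition near_bij l :=
  forall d : R, 0 < d -> exists2 a, modc a < d & bij_on N (shift V (l + a)).

Lemma near_bij_browder l : semi_fredholm N (shift V l) -> near_bij l ->
  exists p, browder N (shift V l) p /\ nclosed nm (ran_on N (iter p (shift V l))).
Proof.
move=> sf nl; have bl := bop_shift l bN.
have [cP [k hk]] := semi_fredholm_powers bl sf.
exists k; split; last exact: cP.
by apply: limit_bij_browder => // d /nl[a ad ba]; exists a => //; rewrite shiftD.
Qed.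

Lemma near_bij_open l : l != 0 -> near_bij l -> exists2 d : R, 0 < d &
  forall a, a != 0 -> modc a < d -> bij_on N (shift V (l + a)).
Proof.
move=> l0 nl; have [p [bp cp]] := near_bij_browder (rV l0) nl.
have [d d0 hd] := browder_open (bop_shift l bN) bp cp.
by exists d => // a a0 ad; rewrite -shiftD; exact: hd.
Qed.

Lemma bij_far : exists2 B : R, 0 < B & forall l, B < modc l -> bij_on N (shift V l).
Proof.
have [sN cN iN hf [B0 /pos_bound[B B1 hB]]] := bN.
exists (2 * B) => [|l Bl]; first by rewrite mulr_gt0.
have l0 : 0 < modc l by apply: lt_trans Bl; rewrite mulr_gt0.
have lne : l != 0 by apply: contraTneq l0 => ->; rewrite modc0 ltxx.
have [_ _ is_ hs [Bs hBs]] := bop_shift l bN.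
split.
  move=> x Nx kx; apply: contrapT => /(nm_gt0 H) nx.
  have fx : V x = l *: x by apply/eqP; rewrite -subr_eq0; apply/eqP.
  by have := hB x; rewrite fx (nmZ H); nra.
apply/seteqP; split=> y; first by move=> [x Nx <-]; exact: is_.
move=> Ny.
have [|x [Nx ex _]] := @approx_surj _ _ _ _ _ H H _ _ _ hs hBs sN cN N (modc l)^-1 _ y Ny.
(* The first term of the Neumann series; the remainder V y / l has at most half the norm of y. *)
- move=> {}y {}Ny; exists (- l^-1 *: y).
  have -> : y - shift V l (- l^-1 *: y) = l^-1 *: V y.
    rewrite /Defs.shift (linZ hf) scalerA mulrN divff// scaleN1r opprK opprD.
    by rewrite scaleNr opprK addrC addrNK.
  split.
  + exact: subspZ.
  + by rewrite (nmZ H) modcN modcV.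
  + by apply: subspZ => //; exact: iN.
  rewrite (nmZ H) modcV ler_pdivrMl//; apply: le_trans (hB y) _.
  by have := nm_ge0 H y; nra.
by exists x.
Qed.

(* The property is open and closed along the ray through [l0], and holds far out
   on it. *)
Lemma near_bij_all l0 : l0 != 0 -> near_bij l0.
Proof.
move=> l0n; have L := modc_gt0 l0n; have [B B0 hB] := bij_far.
have near_of_bij l : bij_on N (shift V l) -> near_bij l.
  by move=> b d d0; exists 0; rewrite ?modc0// addr0.
(* S collects the t >= 1 beyond which the whole ray is good; the claim is that its infimum is 1. *)
pose S : set R := [set t | 1 <= t /\ forall s, t <= s -> near_bij (rc s * l0)].
have mS s : 0 <= s -> modc (rc s * l0) = s * modc l0.
  by move=> s0; rewrite modcM modc_rc ger0_norm.
have S0 : S !=set0.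
  exists (1 + B / modc l0); split.
    by rewrite lerDl divr_ge0 ?modc_ge0// ltW.
  move=> s hs; apply: near_of_bij; apply: hB.
  have p0 : 0 <= B / modc l0 by rewrite divr_ge0 ?modc_ge0// ltW.
  rewrite mS; last by lra.
  by rewrite -ltr_pdivrMr//; lra.
have lS : lbound S 1 by move=> t [].
have hI : has_inf S by split=> //; exists 1.
have t1 : 1 <= inf S by exact: lb_le_inf.
have nt : near_bij (rc (inf S) * l0).
  move=> d d0; have e0 : 0 < d / 2 / modc l0 by rewrite !divr_gt0.
  have [s [s1 hs] st] := inf_adherent e0 hI.
  have ts : inf S <= s by apply: ge_inf; [case: hI|].
  have [|a ad ba] := hs s (lexx s) (d / 2); first by rewrite divr_gt0.
  exists (rc (s - inf S) * l0 + a).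
    apply: le_lt_trans (modcD _ _) _.
    rewrite mS ?subr_ge0//.
    have : (s - inf S) * modc l0 < d / 2 by rewrite -ltr_pdivlMr//; lra.
    by lra.
  by rewrite addrA -mulrDl -rcD (addrC (inf S)) subrK.
have tn : rc (inf S) * l0 != 0.
  rewrite mulf_neq0//; apply/eqP => /(rcI (s := 0)); lra.
have [d d0 hd] := near_bij_open tn nt.
have above s : inf S < s -> near_bij (rc s * l0).
  move=> ts; have e0 : 0 < s - inf S by rewrite subr_gt0.
  have [s' [_ hs'] ss] := inf_adherent e0 hI.
  by apply: hs'; lra.
have [t1'|t1'] := ltP 1 (inf S); last first.
  have e : inf S = 1 by apply/eqP; rewrite eq_le t1 t1'.
  by move: nt; rewrite e (_ : rc 1 = 1)// mul1r.
exfalso.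
(* A whole punctured disc of radius d around the infimum is bijective, so an infimum above 1 could
   be lowered by d / 2, measured along the ray. *)
pose t' := Num.max 1 (inf S - d / 2 / modc l0).
have e0 : 0 < d / 2 / modc l0 by rewrite !divr_gt0.
have t'S : S t'.
  split; first by rewrite le_max lexx.
  move=> s; rewrite ge_max => /andP[s1 sd].
  have [ss|ss|->//] := ltgtP s (inf S); last exact: above.
  apply: near_of_bij.
  have -> : rc s * l0 = rc (inf S) * l0 + rc (s - inf S) * l0.
    by rewrite -mulrDl -rcD addrC subrK.
  apply: hd.
    rewrite mulf_neq0//; apply/eqP => /(rcI (s := 0)); lra.
  rewrite modcM modc_rc ltr0_norm ?subr_lt0// opprB.
  have : (inf S - s) * modc l0 <= d / 2 by rewrite -ler_pdivlMr//; lra.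
  by lra.
have : inf S <= t' by apply: ge_inf; [case: hI|].
by rewrite /t' le_max => /orP[]; lra.
Qed.

Lemma near_bij0 : near_bij 0.
Proof.
move=> d d0; have d2 : 0 < d / 2 by rewrite divr_gt0.
have dn : rc (d / 2) != 0 by apply/eqP => /(rcI (s := 0)); lra.
have [a ad ba] := near_bij_all dn d2.
exists (rc (d / 2) + a); last by rewrite add0r.
apply: le_lt_trans (modcD _ _) _; rewrite modc_rc gtr0_norm//; lra.
Qed.

(** This includes l = 0, where semi-Fredholmness has to come from elsewhere. *)
Lemma riesz_browder l : semi_fredholm N (shift V l) ->
  exists p, browder N (shift V l) p.
Proof.
move=> sf; have [|p [bp _]] := near_bij_browder sf; last by exists p.
by have [->|l0] := eqVneq l 0; [exact: near_bij0|exact: near_bij_all].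
Qed.
End Riesz.
End Browder.

(** * Direct sums of a Kato and a Riesz operator *)

Section Decomposition.
Variables (R : realType) (X : completeNormedModType (Cplx R)).
Local Notation nm := (@nm R X).
Local Notation H := (nm_banach X).
Local Notation shift := Defs.shift.
Implicit Types (f g : X -> X) (l : Cplx R).

Definition complementary (M N : set X) :=
  (forall x, M x -> N x -> x = 0) /\
  (forall x, exists m n, [/\ M m, N n & x = m + n]).

Lemma complementaryC M N : complementary M N -> complementary N M.
Proof.
move=> [h1 h2]; split=> [x Nx Mx|x]; first exact: h1.
by have [m [n [Mm Nn ->]]] := h2 x; exists n, m; rewrite addrC.
Qed.

Section Algebraic.
Variables (M N : set X) (g : X -> X).
Hypotheses (sM : subsp M) (sN : subsp N) (MN : complementary M N).
Hypotheses (hg : lin g) (iM : forall x, M x -> M (g x)) (iN : forall x, N x -> N (g x)).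

Lemma compl_eq0 m n : M m -> N n -> m + n = 0 -> m = 0 /\ n = 0.
Proof.
move=> Mm Nn e; have n0 : n = 0.
  apply: MN.1 => //; have -> : n = - m by apply/eqP; rewrite -addr_eq0 addrC e.
  exact: subspN.
by move: e; rewrite n0 addr0.
Qed.

Lemma sT : subsp [set: X]. Proof. by []. Qed.

Lemma ker_compl x : ker_on setT g x ->
  exists m n, [/\ ker_on M g m, ker_on N g n & x = m + n].
Proof.
have [m [n [Mm Nn ->]]] := MN.2 x; rewrite /ker_on /= (linD hg) => -[_ e].
by have [em en] := compl_eq0 (iM Mm) (iN Nn) e; exists m, n.
Qed.

Lemma ran_compl y : ran_on setT g y ->
  exists m n, [/\ ran_on M g m, ran_on N g n & y = m + n].
Proof.
move=> [x _ <-]; have [m [n [Mm Nn ->]]] := MN.2 x.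
by exists (g m), (g n); rewrite (linD hg); split=> //; [exists m|exists n].
Qed.

Lemma ran_sub_setT (A : set X) : ran_on A g `<=` ran_on setT g.
Proof. by move=> _ [x _ <-]; exists x. Qed.

Lemma ranI_compl : M `&` ran_on setT g = ran_on M g.
Proof.
apply/seteqP; split=> y; last first.
  by move=> [x Mx <-]; split; [exact: iM|exists x].
move=> [My /ran_compl[m [n [[x Mx ex] [z Nz ez] e]]]].
have Nn : N n by rewrite -ez; exact: iN.
have n0 : n = 0.
  apply: MN.1 => //; have -> : n = y - m by rewrite e addrC addKr.
  by apply: subspB => //; rewrite -ex; exact: iM.
by exists x => //; rewrite e n0 addr0.
Qed.

Lemma qfin_ker_compl : qfin (ker_on setT g) [set 0] -> qfin (ker_on M g) [set 0].
Proof.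
move=> [k qk]; have [||a [b [qa _ _]]] := qdim_split (@subsp_set0 _ X) (ker_subsp sM hg) _ _ qk.
- by move=> _ ->; exact: subsp0 (ker_subsp sM hg).
- by move=> x [_ kx].
by exists a.
Qed.

Lemma qfin_ran_compl : qfin setT (ran_on setT g) -> qfin M (ran_on M g).
Proof.
rewrite -ranI_compl; apply: (@qfin_image_inv _ _ _ id) => //.
exact: ran_subsp.
Qed.
End Algebraic.

Section Dims.
Variables (M N : set X) (g : X -> X).
Hypotheses (sM : subsp M) (sN : subsp N) (MN : complementary M N).
Hypotheses (hg : lin g) (iM : forall x, M x -> M (g x)) (iN : forall x, N x -> N (g x)).

Lemma qdim_ker_compl a b : qdim (ker_on M g) [set 0] a -> qdim (ker_on N g) [set 0] b ->
  qdim (ker_on setT g) [set 0] (a + b).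
Proof.
move=> qa qb; apply: (qdim_add qa).
apply: (@qdim_image _ _ _ id _ (ker_on N g)) => //.
- exact: ker_subsp.
- exact: ker_subsp.
- exact: ker_subsp (@sT) hg.
- by move=> x [_ kx].
- by move=> _ [x [_ kx] <-].
- move=> y /(ker_compl sM MN hg iM iN) [m [n [km kn ->]]].
  by exists n, m; rewrite addrC.
have -> // : ker_on N g `&` id @^-1` ker_on M g = [set 0].
apply/seteqP; split=> x; first by move=> [[Nx _] [Mx _]]; exact: MN.1.
by move=> ->; split; [exact: subsp0 (ker_subsp sN hg)|exact: subsp0 (ker_subsp sM hg)].
Qed.

(** The quotient is filtered through W = M + g(N): W / g(X) is M / g(M), and X / W is N / g(N). *)
Lemma qdim_ran_compl a b : qdim M (ran_on M g) a -> qdim N (ran_on N g) b ->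
  qdim setT (ran_on setT g) (a + b).
Proof.
move=> qa qb; have sR A : subsp A -> subsp (ran_on A g) by move=> sA; exact: ran_subsp.
pose W := setsum M (ran_on N g).
have sW : subsp W.
  split; first by exists 0; [exact: subsp0|exists 0; [exact: subsp0 (sR N sN)|rewrite addr0]].
  move=> c _ _ [x Mx [u Ru <-]] [y My [v Rv <-]].
  exists (c *: x + y); first exact: sM.2.
  by exists (c *: u + v); [exact: (sR N sN).2|rewrite scalerDr addrACA].
have RW : ran_on setT g `<=` W.
  move=> y /(ran_compl MN hg)[m [n [[x Mx <-] Rn ->]]].
  by exists (g x); [exact: iM|exists n].
apply: (@qdim_add _ _ _ W).
  apply: (@qdim_image _ _ _ id _ M) => //.
  - exact: (sR setT sT).
  - by move=> _ [x Mx <-]; exists x => //; exists 0; [exact: subsp0 (sR N sN)|rewrite addr0].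
  - move=> _ [x Mx [u Ru <-]]; exists x, u; split=> //; exact: ran_sub_setT Ru.
  - by rewrite (ranI_compl sM MN hg iM iN).
apply: (@qdim_image _ _ _ id _ N) => //.
- move=> y _; have [m [n [Mm Nn ->]]] := MN.2 y; exists n, m; rewrite addrC; split=> //.
  by exists m => //; exists 0; [exact: subsp0 (sR N sN)|rewrite addr0].
have -> // : N `&` id @^-1` W = ran_on N g.
apply/seteqP; split=> x; last first.
  move=> Rx; split; first exact: ran_sub Rx.
  by exists 0; [exact: subsp0|exists x; rewrite ?add0r].
move=> [Nx [m Mm [r Rr e]]]; have Nr : N r by exact: ran_sub Rr.
have -> // : x = r.
have [] := @compl_eq0 M N sM MN m (r - x) Mm (subspB sN Nr Nx).
  by rewrite addrA e subrr.
by move=> _ /subr0_eq.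
Qed.
End Dims.

Section Topological.
Variables (M N : set X).
Hypotheses (sM : subsp M) (sN : subsp N) (MN : complementary M N).
Hypotheses (cM : nclosed nm M) (cN : nclosed nm N).

(** Boundedness of the projection onto M along N, by open mapping for addition on M x N. *)
Lemma proj_bound : exists2 C, 0 < C & forall m n, M m -> N n -> nm m <= C * nm (m + n).
Proof.
pose E : lmodType (Cplx R) := (X * X)%type.
pose s (p : E) : X := p.1 + p.2.
pose D : set E := [set p | M p.1 /\ N p.2].
have HE := prod_banach H H.
have hs : lin s by move=> a x y; rewrite /s /= scalerDr addrACA.
have bs p : nm (s p) <= 1 * (nm p.1 + nm p.2) by rewrite mul1r (nmD H).
have sD : subsp D.
  split; first by split; [exact: (subsp0 sM)|exact: (subsp0 sN)].
  by move=> a x y [? ?] [? ?]; split; [exact: sM.2|exact: sN.2].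
have cD : nclosed (fun p : E => nm p.1 + nm p.2) D.
  move=> x hx; split; [apply: cM|apply: cN] => e e0; have [y [My Ny] xy] := hx e e0.
    by exists y.1 => //; have := nm_ge0 H (x - y).2; move: xy => /=; lra.
  by exists y.2 => //; have := nm_ge0 H (x - y).1; move: xy => /=; lra.
have eT : s @` D = setT.
  apply/seteqP; split=> // x _; have [m [n [Mm Nn ->]]] := MN.2 x.
  by exists (m, n).
have [|C C0 hC] := open_mapping HE H hs bs sD cD; first by rewrite eT.
exists C => // m n Mm Nn; have [|[m' n'] [[/= Mm' Nn'] e le]] := hC (m + n).
  by rewrite eT.
have [] := @compl_eq0 M N sM MN (m' - m) (n' - n) (subspB sM Mm' Mm) (subspB sN Nn' Nn).
  by rewrite addrACA -opprD -e /s /= subrr.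
move=> /subr0_eq mm _; rewrite -{1}mm; move: le => /=; have := nm_ge0 H n'; lra.
Qed.

Lemma setsum_closed (Y Z : set X) : Y `<=` M -> Z `<=` N ->
  nclosed nm Y -> nclosed nm Z -> nclosed nm (setsum Y Z).
Proof.
move=> YM ZN cY cZ x hx; have [C C0 hC] := proj_bound.
have [m [n [Mm Nn e]]] := MN.2 x.
have hd d : 0 < d -> exists y z, [/\ Y y, Z z, nm (m - y) < d & nm (n - z) < d].
  (* The component in M costs a factor C; the one in N is the total minus it and costs C + 1. *)
  move=> d0; have [|_ [y Yy [z Zz <-]] xy] := hx (d / (C + 1)).
    by rewrite divr_gt0// addr_gt0.
  rewrite ltr_pdivlMr ?addr_gt0// in xy.
  have e' : x - (y + z) = (m - y) + (n - z) by rewrite e opprD addrACA.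
  have h := hC (m - y) (n - z) (subspB sM Mm (YM _ Yy)) (subspB sN Nn (ZN _ Zz)).
  rewrite -e' in h; have h0 := nm_ge0 H (x - (y + z)).
  exists y, z; split=> //; first by lra.
  have -> : n - z = (x - (y + z)) - (m - y) by rewrite e' addrAC subrr add0r.
  by apply: le_lt_trans (nmB H _ _) _; lra.
exists m; first by apply: cY => d /hd[y [z [Yy _ my _]]]; exists y.
exists n; last by rewrite e.
by apply: cZ => d /hd[y [z [_ Zz _ nz]]]; exists z.
Qed.
End Topological.
End Decomposition.

(** * Ascent and descent on the Kato part *)

Section Main.
Variables (R : realType) (X : completeNormedModType (Cplx R)).
Local Notation nm := (@nm R X).
Local Notation H := (nm_banach X).
Local Notation shift := Defs.shift.
Implicit Types (l : Cplx R).

(** A kernel vector is A^p z by the Kato condition; then z is in ker A^(p+1) = ker A^p, so the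
    vector is 0. *)
Lemma kato_ker_trivial (M : set X) A : bop M A -> ker_in_core M A 0 ->
  fin_ascent_on setT A -> ker_on M A = [set 0].
Proof.
move=> bM h0 [p ep]; have [sM _ _ hA _] := bM.
apply/seteqP; split=> x; last by move=> ->; exact: subsp0 (ker_subsp sM hA).
move=> kx; have [|z Mz ez] := h0 p x; first by split=> //; rewrite ran_iter0; case: kx.
have : ker_on setT (iter p.+1 A) z by split=> //=; rewrite ez; case: kx.
by rewrite -ep -ez => -[].
Qed.

(** Finite descent gives A^q y = A^(q+1) m with m in M, so y - A m is in ker A^q, and the Kato
    condition puts this kernel inside ran A. *)
Lemma kato_ran_full (M N : set X) A : bop M A -> bop N A -> complementary M N ->
  ker_in_core M A 0 -> fin_descent_on setT A -> ran_on M A = M.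
Proof.
move=> bM bN MN h0 [q eq]; have [sM _ iM hA _] := bM; have [sN _ _ _ _] := bN.
have hq j := lin_iter j hA.
apply/seteqP; split; first exact: ran_sub.
(* A^j u is a kernel vector, hence equal to A^(j+1) v; then u - A v is killed by A^j. *)
have kr j u : M u -> iter j A u = 0 -> ran_on M A u.
  elim: j u => [|j IH] u Mu /= ju; first by rewrite ju; exact: subsp0 (ran_subsp sM hA).
  have [|v Mv ev] := h0 j.+1 (iter j A u).
    by split; [split=> //|rewrite ran_iter0]; exact: (bop_inv (bop_iter j bM)).
  rewrite -(subrK (A v) u); apply: (subspD (ran_subsp sM hA)); last by exists v.
  apply: IH; first by apply: subspB => //; exact: iM.
  by rewrite (linB (hq j)) -iterSr ev subrr.
move=> y My; have : ran_on setT (iter q A) (iter q A y) by exists y.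
rewrite eq => -[w _]; have [m [n [Mm Nn ->]]] := MN.2 w => ew.
have [] := @compl_eq0 _ _ M N sM MN (iter q.+1 A m - iter q A y) (iter q.+1 A n).
- by apply: subspB => //; exact: (bop_inv (bop_iter _ bM)).
- exact: (bop_inv (bop_iter _ bN)).
- by rewrite addrAC -(linD (hq q.+1)) ew subrr.
move=> e _; rewrite -(subrK (A m) y).
apply: (subspD (ran_subsp sM hA)); last by exists m.
apply: (kr q); first by apply: subspB => //; exact: iM.
by rewrite (linB (hq q)) -iterSr -opprB e oppr0.
Qed.

Lemma fin_ascent_compl (M N : set X) A p : bop M A -> bop N A -> complementary M N ->
  ker_on M A = [set 0] -> browder N A p -> fin_ascent_on setT A.
Proof.
move=> bM bN MN k0 [ek _]; have [sM _ iM hA _] := bM; have [sN _ _ _ _] := bN.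
exists p; apply/seteqP; split=> x; first exact: ker_iter_inc.
move=> /(ker_compl sM MN (lin_iter _ hA) (bop_inv (bop_iter _ bM)) (bop_inv (bop_iter _ bN))).
move=> [m [n [[Mm km] kn ->]]].
have -> : m = 0.
  elim: p.+1 m Mm km => [//|j IH] m Mm; rewrite iterSr => /(IH _ (iM _ Mm)) Am.
  by have : ker_on M A m by []; rewrite k0.
by rewrite add0r; move: kn; rewrite -ek => -[].
Qed.

Lemma fin_descent_compl (M N : set X) A p : bop M A -> bop N A -> complementary M N ->
  ran_on M A = M -> browder N A p -> fin_descent_on setT A.
Proof.
move=> bM bN MN r0 [_ er]; have [sM _ iM hA _] := bM; have [sN _ _ _ _] := bN.
have hp := lin_iter p hA; have hp1 := lin_iter p.+1 hA.
exists p; apply/seteqP; split=> x; last exact: ran_iter_dec.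
move=> [y _ <-]; have [m [n [Mm Nn ->]]] := MN.2 y.
have : M m by []; rewrite -{1}r0 => -[m' Mm' <-].
have : ran_on N (iter p A) (iter p A n) by exists n.
rewrite er => -[n' Nn' en].
by exists (m' + n') => //; rewrite (linD hp1) (linD hp) en iterSr.
Qed.

(** * Transfer of class membership between points of the disc *)

Section Transfer.
Variables (f : X -> X) (M N : set X) (e C : R).
Hypotheses (bM : bop M f) (bN : bop N f) (MN : complementary M N) (C0 : 0 < C).
Hypothesis kato : forall l, modc l < e ->
  reg M (shift f l) C /\ ker_in_core M (shift f l) 0.
Hypothesis riesz : forall l, l != 0 -> semi_fredholm N (shift f l).

Let sM := bop_sub bM.
Let sN := bop_sub bN.
Let hs l : lin (shift f l) := lin_shift l (bop_lin bM).
Let iM l := bop_inv (bop_shift l bM).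
Let iN l := bop_inv (bop_shift l bN).
Let NM := complementaryC MN.
Let sKT l : subsp (ker_on setT (shift f l)) := ker_subsp (@sT R X) (hs l).
Let sRT l : subsp (ran_on setT (shift f l)) := ran_subsp (@sT R X) (hs l).
Let s0 := @subsp_set0 _ X.

Lemma kato_qdim_ker l l' a : modc l < e -> modc l' < e ->
  qdim (ker_on M (shift f l)) [set 0] a -> qdim (ker_on M (shift f l')) [set 0] a.
Proof.
have sK j := ker_subsp sM (hs j).
have z j : [set 0] `<=` ker_on M (shift f j) by move=> _ ->; exact: subsp0 (sK j).
have D j m le := (kato_dims bM C0 (fun l le => (kato le).1) (l := j) m le).1.
move=> le le' /(qdimP a (sK l) s0 (z l)) h; apply/(qdimP a (sK l') s0 (z l')).
by rewrite !D//; move: h; rewrite !D.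
Qed.

Lemma kato_qdim_ran l l' a : modc l < e -> modc l' < e ->
  qdim M (ran_on M (shift f l)) a -> qdim M (ran_on M (shift f l')) a.
Proof.
have sR j := ran_subsp sM (hs j).
have z j : ran_on M (shift f j) `<=` M := ran_sub (iM j).
have D j m le := (kato_dims bM C0 (fun l le => (kato le).1) (l := j) m le).2.
move=> le le' /(qdimP a sM (sR l) (z l)) h; apply/(qdimP a sM (sR l') (z l')).
by rewrite !D//; move: h; rewrite !D.
Qed.

Lemma riesz_index l : semi_fredholm N (shift f l) ->
  (exists p, browder N (shift f l) p) /\
  ((qfin (ker_on N (shift f l)) [set 0] \/ qfin N (ran_on N (shift f l))) ->
   exists n, qdim (ker_on N (shift f l)) [set 0] n /\ qdim N (ran_on N (shift f l)) n).
Proof.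
move=> sf; have [p bp] := riesz_browder bN riesz sf; split; first by exists p.
exact: browder_index (bop_shift l bN) bp.
Qed.

Lemma riesz_index_ne0 l : l != 0 ->
  exists n, qdim (ker_on N (shift f l)) [set 0] n /\ qdim N (ran_on N (shift f l)) n.
Proof.
move=> l0; have sf := riesz l0; have [_] := riesz_index sf; apply.
by case: sf => [[]|]; [left|right].
Qed.

Lemma finite_dim_compl l : finite_dim (ker_on setT (shift f l)) ->
  qfin (ker_on M (shift f l)) [set 0] /\ qfin (ker_on N (shift f l)) [set 0].
Proof.
by move=> /(finite_dimP (sKT l)) h; split; apply: qfin_ker_compl h.
Qed.

Lemma finite_codim_compl l : finite_codim setT (ran_on setT (shift f l)) ->
  qfin M (ran_on M (shift f l)) /\ qfin N (ran_on N (shift f l)).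
Proof.
move=> /(finite_codimP (@sT R X) (sRT l)) h; have {}h := h (fun _ _ => I); split.
  exact: (qfin_ran_compl sM MN (hs l) (iM l) (iN l)).
exact: (qfin_ran_compl sN NM (hs l) (iN l) (iM l)).
Qed.

(** At l = 0 this is the only source of information on N: the range on N is N intersected with the
    whole range, hence closed. *)
Lemma phi_plus_semi_fredholm l : PhiPlus_on setT (shift f l) -> semi_fredholm N (shift f l).
Proof.
move=> [/finite_dim_compl[_ kN] /closed_nclosed cR]; left; split=> //.
rewrite -(ranI_compl sN NM (hs l) (iN l) (iM l)) => x hx; split.
  by apply: (bop_closed bN) => d /hx[y [Ny _] xy]; exists y.
by apply: cR => d /hx[y [_ Ry] xy]; exists y.
Qed.

Lemma phi_minus_semi_fredholm l : PhiMinus_on setT (shift f l) -> semi_fredholm N (shift f l).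
Proof. by move=> /finite_codim_compl[_ h]; right. Qed.

Variables (l l' : Cplx R).
Hypotheses (le : modc l < e) (le' : modc l' < e) (l'0 : l' != 0).

Lemma phi_plus_of_kato : qfin (ker_on M (shift f l)) [set 0] -> PhiPlus_on setT (shift f l').
Proof.
move=> [a /(kato_qdim_ker le le') qa]; have [n [qn qn']] := riesz_index_ne0 l'0.
split.
  apply/(finite_dimP (sKT l')); exists (a + n)%N.
  exact: (qdim_ker_compl sM sN MN (hs l') (iM l') (iN l')).
have cM := reg_closed (bop_shift l' bM) (kato le').1.
have cN : nclosed nm (ran_on N (shift f l')).
  have [cP _] := semi_fredholm_powers (bop_shift l' bN) (riesz l'0).
  exact: (cP 1%N).
apply/closed_nclosed.
have -> : ran_on setT (shift f l') = setsum (ran_on M (shift f l')) (ran_on N (shift f l')).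
  apply/seteqP; split=> y.
    move=> /(ran_compl MN (hs l'))[m [n0 [Rm Rn ->]]].
    by exists m => //; exists n0.
  move=> [u Ru [v Rv <-]]; apply: (subspD (sRT l')); [exact: ran_sub_setT Ru|exact: ran_sub_setT Rv].
apply: (setsum_closed sM sN MN (bop_closed bM) (bop_closed bN)) => //.
- exact: ran_sub (iM l').
- exact: ran_sub (iN l').
Qed.

Lemma phi_minus_of_kato : qfin M (ran_on M (shift f l)) -> PhiMinus_on setT (shift f l').
Proof.
move=> [a /(kato_qdim_ran le le') qa]; have [n [qn qn']] := riesz_index_ne0 l'0.
apply/(finite_codimP (@sT R X) (sRT l')) => //; exists (a + n)%N.
exact: (qdim_ran_compl sM sN MN (hs l') (iM l') (iN l')).
Qed.

Lemma phi_plus_transfer : PhiPlus_on setT (shift f l) -> PhiPlus_on setT (shift f l').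
Proof. by move=> [/finite_dim_compl[kM _] _]; exact: phi_plus_of_kato. Qed.

Lemma phi_minus_transfer : PhiMinus_on setT (shift f l) -> PhiMinus_on setT (shift f l').
Proof. by move=> /finite_codim_compl[kM _]; exact: phi_minus_of_kato. Qed.

Lemma index_compl j a b n :
  qdim (ker_on M (shift f j)) [set 0] a -> qdim M (ran_on M (shift f j)) b ->
  qdim (ker_on N (shift f j)) [set 0] n -> qdim N (ran_on N (shift f j)) n ->
  is_dim (ker_on setT (shift f j)) (a + n) /\
  is_codim setT (ran_on setT (shift f j)) (b + n).
Proof.
move=> qa qb qn qn'; split.
  apply/(is_dimP _ (sKT j)).
  exact: (qdim_ker_compl sM sN MN (hs j) (iM j) (iN j)).
apply/(is_codimP _ (@sT R X) (sRT j)) => //.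
exact: (qdim_ran_compl sM sN MN (hs j) (iM j) (iN j)).
Qed.

Lemma is_dim_uniq (Y : set X) m n : subsp Y -> is_dim Y m -> is_dim Y n -> m = n.
Proof. by move=> sY /(is_dimP _ sY) hm /(is_dimP _ sY); exact: qdim_uniq. Qed.

Lemma is_codim_uniq (Y : set X) m n : subsp Y ->
  is_codim setT Y m -> is_codim setT Y n -> m = n.
Proof.
move=> sY /(is_codimP _ (@sT R X) sY (fun _ _ => I)) hm.
by move=> /(is_codimP _ (@sT R X) sY (fun _ _ => I)); exact: qdim_uniq.
Qed.

(** N contributes n at l, and m at l', to both kernel dimension and codimension; what remains is the
    inequality a <= b on M, which is the same at both points. *)
Lemma ind_le0_transfer : PhiPlus_on setT (shift f l) ->
  ind_le0 setT (shift f l) -> ind_le0 setT (shift f l').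
Proof.
move=> pl il; have [[a qa] kN] := finite_dim_compl pl.1.
have [_ hi] := riesz_index (phi_plus_semi_fredholm pl).
have [n [qn qn']] := hi (or_introl kN).
have [m [qm qm']] := riesz_index_ne0 l'0.
(* Infinite codimension on M persists at l', which is the first alternative of [ind_le0]. *)
have [[b qb]|nb] := EM (qfin M (ran_on M (shift f l))); last first.
  left=> /finite_codim_compl[[b qb] _]; apply: nb; exists b.
  exact: kato_qdim_ran qb.
have [d1 d2] := index_compl qa qb qn qn'.
have [d1' d2'] := index_compl (kato_qdim_ker le le' qa) (kato_qdim_ran le le' qb) qm qm'.
right; exists (a + m)%N, (b + m)%N; split=> //; split=> //.
case: il => [nf|[x [y [dx [dy xy]]]]].
  by exfalso; apply: nf; have [[s [_ hs']] _] := d2; exists s.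
move: xy; rewrite (is_dim_uniq (sKT l) dx d1) (is_codim_uniq (sRT l) dy d2).
by rewrite !leq_add2r.
Qed.

Lemma ind_ge0_transfer : PhiMinus_on setT (shift f l) ->
  ind_ge0 setT (shift f l) -> ind_ge0 setT (shift f l').
Proof.
move=> pl il; have [[b qb] kN] := finite_codim_compl pl.
have [_ hi] := riesz_index (phi_minus_semi_fredholm pl).
have [n [qn qn']] := hi (or_intror kN).
have [m [qm qm']] := riesz_index_ne0 l'0.
have [[a qa]|na] := EM (qfin (ker_on M (shift f l)) [set 0]); last first.
  left=> /finite_dim_compl[[a qa] _]; apply: na; exists a.
  exact: kato_qdim_ker qa.
have [d1 d2] := index_compl qa qb qn qn'.
have [d1' d2'] := index_compl (kato_qdim_ker le le' qa) (kato_qdim_ran le le' qb) qm qm'.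
right; exists (a + m)%N, (b + m)%N; split=> //; split=> //.
case: il => [nf|[x [y [dx [dy xy]]]]].
  by exfalso; apply: nf; have [[s [_ hs']] _] := d1; exists s.
move: xy; rewrite (is_dim_uniq (sKT l) dx d1) (is_codim_uniq (sRT l) dy d2).
by rewrite !leq_add2r.
Qed.

Lemma Bplus_of_ker : ker_on M (shift f l) = [set 0] -> BPlus_on setT (shift f l').
Proof.
move=> k0; have q0 : qdim (ker_on M (shift f l)) [set 0] 0 by rewrite k0; exact: qdim_refl.
split; first by apply: phi_plus_of_kato; exists 0%N.
have [[p bp] _] := riesz_index (riesz l'0).
apply: (fin_ascent_compl (bop_shift l' bM) (bop_shift l' bN) MN _ bp).
exact: qdim0 (kato_qdim_ker le le' q0).
Qed.

Lemma Bminus_of_ran : ran_on M (shift f l) = M -> BMinus_on setT (shift f l').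
Proof.
move=> k0; have q0 : qdim M (ran_on M (shift f l)) 0 by rewrite k0; exact: qdim_refl.
split; first by apply: phi_minus_of_kato; exists 0%N.
have [[p bp] _] := riesz_index (riesz l'0).
apply: (fin_descent_compl (bop_shift l' bM) (bop_shift l' bN) MN _ bp).
exact/esym/(qdim0 (kato_qdim_ran le le' q0)).
Qed.

Lemma ascent_ker : fin_ascent_on setT (shift f l) -> ker_on M (shift f l) = [set 0].
Proof. exact: kato_ker_trivial (bop_shift l bM) (kato le).2. Qed.

Lemma descent_ran : fin_descent_on setT (shift f l) -> ran_on M (shift f l) = M.
Proof. exact: kato_ran_full (bop_shift l bM) (bop_shift l bN) MN (kato le).2. Qed.

Lemma class_transfer c : in_class c (shift f l) -> in_class c (shift f l').
Proof.
case: c => /=.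
- by move=> [_ /ascent_ker]; exact: Bplus_of_ker.
- by move=> [_ /descent_ran]; exact: Bminus_of_ran.
- move=> [_ [/ascent_ker/Bplus_of_ker[pp fa] /descent_ran/Bminus_of_ran[pm fd]]].
  by split.
- exact: phi_plus_transfer.
- exact: phi_minus_transfer.
- by move=> [/phi_plus_transfer pp /phi_minus_transfer pm].
- by move=> [pp il]; split; [exact: phi_plus_transfer|exact: ind_le0_transfer].
- by move=> [pp il]; split; [exact: phi_minus_transfer|exact: ind_ge0_transfer].
- move=> [[pp pm] [il ig]]; split.
    by split; [exact: phi_plus_transfer|exact: phi_minus_transfer].
  by split; [exact: ind_le0_transfer|exact: ind_ge0_transfer].
Qed.

Lemma Bplus_of_bounded_below : bounded_below (shift f l) -> BPlus_on setT (shift f l').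
Proof.
move=> [c [c0 hc]]; apply: Bplus_of_ker; apply/seteqP; split=> x.
  move=> [_ kx]; have := hc x; rewrite kx normr0 pmulr_rle0// normr_le0.
  by move=> /eqP.
by move=> ->; exact: subsp0 (ker_subsp sM (hs l)).
Qed.

Lemma Bminus_of_surj : (forall y, exists x, shift f l x = y) -> BMinus_on setT (shift f l').
Proof.
move=> hy; apply: Bminus_of_ran.
rewrite -(ranI_compl sM MN (hs l) (iM l) (iN l)).
by apply/seteqP; split=> y; [case|split=> //; have [x] := hy y; exists x].
Qed.

Lemma B_of_invertible : invertible (shift f l) -> B_on setT (shift f l').
Proof.
move=> [g [_ [fK gK]]].
have [pp fa] : BPlus_on setT (shift f l').
  apply: Bplus_of_ker; apply/seteqP; split=> x.
    by move=> [_ kx]; have := fK x; rewrite kx -{1}(lin0 (hs l)) fK => <-.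
  by move=> ->; exact: subsp0 (ker_subsp sM (hs l)).
have [pm fd] : BMinus_on setT (shift f l').
  by apply: Bminus_of_surj => y; exists (g y); rewrite gK.
by split.
Qed.
End Transfer.

(** The equation f = T lets the bare function replace the coercion of the linear map in all later
    goals. *)
Lemma gkrd_transfer (T : {linear X -> X}) : continuous T -> GKRD T ->
  exists f M N e C, [/\ f = (T : X -> X), bop M f, bop N f & complementary M N] /\
    [/\ 0 < e, 0 < C,
     forall l, modc l < e -> reg M (shift f l) C /\ ker_in_core M (shift f l) 0 &
     forall l, l != 0 -> semi_fredholm N (shift f l)].
Proof.
move=> cT [M [N [[sM sN cM cN] [[iM iN MN0 MNT] [[cR kT] rT]]]]].
have hT : lin (T : X -> X) by move=> a x y; exact: linearP.
have bT := continuous_nm_bounded cT.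
have bM : bop M T.
  split=> //; first exact/closed_nclosed.
  by move=> x Mx; apply: iM; exists x.
have bN : bop N T.
  split=> //; first exact/closed_nclosed.
  by move=> x Nx; apply: iN; exists x.
have [|n x [kx _]|e [C [e0 C0 hk]]] := kato_perturb bM.
- exact/closed_nclosed.
- exact: kT.
exists T, M, N, e, C; split; split=> //.
  split=> x; first by move=> Mx Nx; have : (M `&` N) x by []; rewrite MN0.
  have : setsum M N x by rewrite MNT.
  by move=> [m Mm [n Nn <-]]; exists m, n.
move=> l l0; right; have [_ pm] := rT l l0.
apply/finite_codimP => //.
  exact: ran_subsp (lin_shift l hT).
exact: ran_sub (bop_inv (bop_shift l bN)).
Qed.

Lemma not_interior (A : set (Cplx R)) (e : R) : 0 < e -> ~ interior A 0 ->
  exists2 l, modc l < e & ~ A l.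
Proof.
move=> e0 nA; apply: contrapT => h; apply: nA; apply/modc_nbhs; exists e => //.
move=> l; rewrite sub0r modcN => le; apply: contrapT => nl; apply: h.
by exists l.
Qed.

Lemma not_limit_point (A : set (Cplx R)) (e : R) : 0 < e ->
  (forall l, modc l < e -> l != 0 -> ~ A l) -> ~ limit_point A 0.
Proof.
move=> e0 h lp; have [|l [l0 Al le]] := lp [set l | modc (0 - l) < e].
  by apply/modc_nbhs; exists e.
by apply: (h l) => //; move: le; rewrite /= sub0r modcN.
Qed.
End Main.

Theorem theorem3p14 (R : realType) (X : completeNormedModType (Cplx R))
  (T : {linear X -> X}) (Tcont : continuous T)
  (Xinf : ~ finite_dim [set: X]) :
  (forall c : opclass, GKRD T ->
     boundary (sigma_class c T) 0 -> isolated (sigma_class c T) 0) /\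
  (GKRD T -> boundary (sigma_ap T) 0 -> ~ limit_point (sigma_class cBPlus T) 0) /\
  (GKRD T -> boundary (sigma_su T) 0 -> ~ limit_point (sigma_class cBMinus T) 0) /\
  (GKRD T -> boundary (spectrum T) 0 -> ~ limit_point (sigma_class cB T) 0).
Proof.
split; [|split; [|split]].
- move=> c /(gkrd_transfer Tcont)[f [M [N [e [C [[<- bM bN MN] [e0 C0 kt rz]]]]]]].
  move=> [cl /(not_interior e0)[l le /contrapT cl_l]].
  have out l' : modc l' < e -> l' != 0 -> ~ sigma_class c f l'.
    by move=> le1 l0; apply; exact: (class_transfer bM bN MN C0 kt rz le le1 l0 cl_l).
  have nb : nbhs (0 : Cplx R) [set l | modc (0 - l) < e].
    by apply/modc_nbhs; exists e.
  have only0 l' : modc (0 - l') < e -> sigma_class c f l' -> l' = 0.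
    rewrite sub0r modcN => le' sl; apply/eqP; apply: contrapT => /negP l0.
    exact: out sl.
  (* By closure the spectrum meets the disc, and 0 is the only point where it can. *)
  have s0 : sigma_class c f 0.
    by have [y [sy ye]] := cl _ nb; have y0 := only0 y ye sy; rewrite y0 in sy.
  split; first by rewrite in_setE.
  exists [set l | modc (0 - l) < e] => //; apply/seteqP; split=> y.
    by move=> [/only0 h /h].
  by move=> ->; split=> //=; rewrite subrr modc0.
- move=> /(gkrd_transfer Tcont)[f [M [N [e [C [[<- bM bN MN] [e0 C0 kt rz]]]]]]].
  move=> [_ /(not_interior e0)[l le /contrapT bb]].
  apply: (not_limit_point e0) => l' le' l0; apply.
  exact: (Bplus_of_bounded_below bM bN MN C0 kt rz le le' l0 bb).
- move=> /(gkrd_transfer Tcont)[f [M [N [e [C [[<- bM bN MN] [e0 C0 kt rz]]]]]]].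
  move=> [_ /(not_interior e0)[l le /contrapT bb]].
  apply: (not_limit_point e0) => l' le' l0; apply.
  exact: (Bminus_of_surj bM bN MN C0 kt rz le le' l0 bb).
- move=> /(gkrd_transfer Tcont)[f [M [N [e [C [[<- bM bN MN] [e0 C0 kt rz]]]]]]].
  move=> [_ /(not_interior e0)[l le /contrapT bb]].
  apply: (not_limit_point e0) => l' le' l0; apply.
  exact: (B_of_invertible bM bN MN C0 kt rz le le' l0 bb).
Qed.
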